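(* The affine Schur algebra $S_\vartriangle(2,2)$ (at $q=1$, over $\mathbb{Q}$) is an affine cellular algebra over $\mathbb{Q}$; that is, there exists a $\mathbb{Q}$-involution $\tau$ of $S_\vartriangle(2,2)$ with respect to which $S_\vartriangle(2,2)$ is affine cellular.
   Context: **The affine Schur algebra $S_\vartriangle(2,2)$ over $\mathbb{Q}$.** Let $I(\mathbb{Z},2)=\mathbb{Z}\times\mathbb{Z}$, with elements $\underline{i}=(i_1,i_2)$. Let $\mathfrak{S}_\vartriangle=\mathfrak{S}_2\ltimes\mathbb{Z}^2$ be the extended affine Weyl group, acting on $I(\mathbb{Z},2)$ from the right, with $\mathfrak{S}_2$ acting by place permutation and $\varepsilon\in\mathbb{Z}^2$ acting by $\underline{i}\mapsto\underline{i}+2\varepsilon$. It acts diagonally on $I(\mathbb{Z},2)\times I(\mathbb{Z},2)$; write $(\underline{i},\underline{j})\sim(\underline{k},\underline{l})$ if the two pairs lie in the same orbit. $S_\vartriangle(2,2)$ is the $\mathbb{Q}$-algebra with basis the symbols $\xi_{\underline{i},\underline{j}}$ ($\underline{i},\underline{j}\in I(\mathbb{Z},2)$), where $\xi_{\underline{i},\underline{j}}$ and $\xi_{\underline{k},\underline{l}}$ are identified if and only if $(\underline{i},\underline{j})\sim(\underline{k},\underline{l})$, and multiplication $$\xi_{\underline{i},\underline{j}}\,\xi_{\underline{k},\underline{l}}=\sum_{(\underline{p},\underline{q})}C(\underline{i},\underline{j},\underline{k},\underline{l},\underline{p},\underline{q})\,\xi_{\underline{p},\underline{q}},\qquad C(\underline{i},\underline{j},\underline{k},\underline{l},\underline{p},\underline{q})=\bigl|\{\underline{s}\in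 I(\mathbb{Z},2): (\underline{i},\underline{j})\sim(\underline{p},\underline{s}),\ (\underline{s},\underline{q})\sim(\underline{k},\underline{l})\}\bigr|,$$ the sum being over representatives $(\underline{p},\underline{q})$ of the $\mathfrak{S}_\vartriangle$-orbits on $I(\mathbb{Z},2)\times I(\mathbb{Z},2)$. The unit is $\xi_{(1,1),(1,1)}+\xi_{(1,2),(1,2)}+\xi_{(2,2),(2,2)}$. **Affine cellular algebras (Koenig–Xi).** Let $k$ be a noetherian domain. A commutative $k$-algebra is called affine if it is a quotient of a polynomial ring $k[x_1,\dots,x_t]$ in finitely many variables. A $k$-involution on a $k$-algebra $A$ is a $k$-linear anti-automorphism $\tau$ with $\tau^2=\mathrm{id}_A$. Let $A$ be a unitary $k$-algebra with a $k$-involution $\tau$. A two-sided ideal $J$ of $A$ is an affine cell ideal if: (1) $\tau(J)=J$. (2) There are a free $k$-module $V$ of finite rank and an affine $k$-algebra $B$ with a $k$-involution $\sigma$ such that $\triangle=V\otimes_k B$ is an $A$-$B$-bimodule, where the right $B$-module structure is induced by that of the regular right module $B_B$. (3) There is an $A$-$A$-bimodule isomorphism $\alpha:J\to\triangle\otimes_B\triangle'$, where $\triangle'=B\otimes_k V$ is a $B$-$A$-bimodule with left $B$-structure induced by ${}_BB$ and right $A$-structure $(b\otimes v)a=p(\tau(a)(v\otimes b))$, with $p:V\otimes_k B\to B\otimes_k V$, $v\otimes b\mapsto b\otimes v$, the switch map. (4) $\alpha\circ\tau|_J=f\circ\alpha$, where $f:\triangle\otimes_B\triangle'\to\triangle\otimes_B\triangle'$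 is given by $v_1\otimes b_1\otimes_B b_2\otimes v_2\mapsto v_2\otimes\sigma(b_2)\otimes_B\sigma(b_1)\otimes v_1$. $A$ (with the $k$-involution $\tau$) is affine cellular if there is a $k$-module decomposition $A=J_1'\oplus\cdots\oplus J_n'$ with $\tau(J_j')=J_j'$ for each $j$, such that $J_i=\bigoplus_{1\le l\le i}J_l'$ gives a chain of two-sided ideals $0=J_0\subset J_1\subset\cdots\subset J_n=A$, and for each $1\le i\le n$ the ideal $J_i/J_{i-1}$ (identified with $J_i'$) is an affine cell ideal of $A/J_{i-1}$ with respect to the involution induced by $\tau$. *)

(* Defs.v *)
From HB Require Import structures.
From mathcomp Require Import all_boot all_order all_algebra.
From mathcomp Require Import finmap boolp classical_sets functions cardinality fsbigop.
From mathcomp Require Import monalg.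
From mathcomp Require mpoly.
From mathcomp Require Import zify.

Set Implicit Arguments.
Unset Strict Implicit.
Unset Printing Implicit Defensive.

Import GRing.Theory.
Local Open Scope classical_set_scope.
Local Open Scope ring_scope.
Local Open Scope quotient_scope.

(** * The affine Schur algebra S(2,2) over the rationals *)

Definition I2 : Type := (int * int)%type.
HB.instance Definition _ := GRing.Zmodule.on I2.

(* The action of the element (w, e) of the semidirect product of S_2 and Z^2;
   the boolean [w] tells whether the permutation is the transposition. *)
Definition aff_act (w : bool) (e : I2) (i : I2) : I2 :=
  (if w then (i.2, i.1) else i) + e *+ 2.

Definition orb_rel (x y : I2 * I2) : bool :=
  `[< exists w e, y = (aff_act w e x.1, aff_act w e x.2) >].

Lemma aff_act_inj w e : injective (aff_act w e).
Proof.
by move=> [a b] [c d]; rewrite /aff_act => /addIr; case: w => //= -[-> ->].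
Qed.

Lemma aff_actK w e : exists e',
  cancel (aff_act w e) (aff_act w e') /\ cancel (aff_act w e') (aff_act w e).
Proof.
case: w; last first.
  exists (- e); split=> a; rewrite /aff_act mulNrn; first by rewrite addrK.
  by rewrite subrK.
case: e => c d; exists (- d, - c).
split=> -[a b]; rewrite /aff_act !mulr2n; congr pair => /=;
  by rewrite -opprD (addrK, subrK).
Qed.

Lemma aff_act_comp w e w' e' : exists w2 e2,
  forall i, aff_act w' e' (aff_act w e i) = aff_act w2 e2 i.
Proof.
exists (w (+) w'), ((if w' then (e.2, e.1) else e) + e') => -[a b].
rewrite /aff_act mulrnDl [RHS]addrA; congr (_ + _).
by rewrite !mulr2n; case: w; case: w' => //=; case: e => c d.
Qed.

Lemma orb_rel_refl : reflexive orb_rel.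
Proof.
by case=> i j; apply/asboolP; exists false, 0; rewrite /aff_act mul0rn !addr0.
Qed.

Lemma orb_rel_sym : symmetric orb_rel.
Proof.
suff H x y : orb_rel x y -> orb_rel y x by move=> x y; apply/idP/idP; apply: H.
move=> /asboolP[w [e ->]]; have [e' [eK _]] := aff_actK w e.
by apply/asboolP; exists w, e'; rewrite /= !eK -surjective_pairing.
Qed.

Lemma orb_rel_trans : transitive orb_rel.
Proof.
move=> y x z /asboolP[w [e ->]] /asboolP[w' [e' ->]]; apply/asboolP.
by have [w2 [e2 E]] := aff_act_comp w e w' e'; exists w2, e2; rewrite /= !E.
Qed.

Definition orb_equiv :=
  EquivRel orb_rel orb_rel_refl orb_rel_sym orb_rel_trans.

Definition orbit : Type := {eq_quot orb_equiv}.
HB.instance Definition _ := Choice.on orbit.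

HB.lock Definition orb (i j : I2) : orbit := \pi_{eq_quot orb_equiv} (i, j).

Definition orb_repr (z : orbit) : I2 * I2 := repr (z : {eq_quot orb_equiv}).

Lemma orbE i j k l : (orb i j == orb k l) = orb_rel (i, j) (k, l).
Proof.
rewrite unlock; exact: sameP eqP (@eqquotP _ _ {eq_quot orb_equiv} (i, j) (k, l)).
Qed.

Lemma orb_reprK z : orb (orb_repr z).1 (orb_repr z).2 = z.
Proof. by rewrite [orb]unlock /orb_repr -surjective_pairing reprK. Qed.

Lemma orb_act w e i j : orb (aff_act w e i) (aff_act w e j) = orb i j.
Proof.
by apply/esym/eqP; rewrite orbE; apply/asboolP; exists w, e.
Qed.

(* The set is finite by [strconst_finite], so [fset_set] is not a default. *)
Definition strconst (i j k l p q : I2) : nat :=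
  #|` fset_set [set s : I2 | orb_rel (i, j) (p, s) /\ orb_rel (s, q) (k, l)]|.


(* The points [s] with [orb p s = x] are finite in number. *)
Definition orb_nbr (x : orbit) (p : I2) : seq I2 :=
  let: (i, j) := orb_repr x in [:: j + (p - i); (j.2, j.1) + (p - (i.2, i.1))].

Lemma mem_orb_nbr p s : s \in orb_nbr (orb p s) p.
Proof.
rewrite /orb_nbr; have := orb_reprK (orb p s).
case: (orb_repr _) => i j /= /eqP; rewrite orbE => /asboolP[w [e]] /= [-> ->].
rewrite !inE /aff_act; apply/orP.
by case: w; [right | left]; apply/eqP; congr (_ + _); rewrite addrC addKr.
Qed.

Lemma strconst_finite i j k l p q :
  finite_set [set s : I2 | orb_rel (i, j) (p, s) /\ orb_rel (s, q) (k, l)].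
Proof.
apply: sub_finite_set (finite_seq (orb_nbr (orb i j) p)) => s /= [].
by rewrite -orbE => /eqP-> _; exact: mem_orb_nbr.
Qed.

Lemma strconst_act w e i j k l p q :
  strconst i j k l (aff_act w e p) (aff_act w e q) = strconst i j k l p q.
Proof.
rewrite /strconst; set A := [set s | _]; set B := [set s | _].
have -> : A = aff_act w e @` B.
  rewrite eqEsubset; split => s; rewrite /A /B /= -!orbE.
  - have [e' [_ e'K]] := aff_actK w e => -[H1 H2]; exists (aff_act w e' s) => //=.
    by rewrite -!orbE -(orb_act w e p) -(orb_act w e _ q) e'K.
  - by move=> [t]; rewrite -!orbE => -[H1 H2] <-; rewrite !orb_act.
rewrite fset_set_image; last exact: strconst_finite.
exact/card_imfset/aff_act_inj.
Qed.

Lemma strconstE i j k l p q (S : {fset I2}) :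
  (forall s, s \notin S -> orb p s != orb i j) ->
  strconst i j k l p q =
    (\sum_(s <- S) (orb p s == orb i j) * (orb s q == orb k l))%N.
Proof.
move=> HS; rewrite /strconst -sum1_size.
rewrite [RHS](eq_bigr (fun s =>
  if orb_rel (i, j) (p, s) && orb_rel (s, q) (k, l) then 1%N else 0%N)); last first.
  by move=> s _; rewrite orbE orb_rel_sym -!orbE; do 2 case: eqP.
rewrite -big_mkcond [in RHS]big_fset_condE; apply: perm_big; apply: uniq_perm => // s.
rewrite in_fset_set; last exact: strconst_finite.
rewrite !inE /=; apply/idP/idP.
- rewrite inE /= => -[H1 H2]; rewrite H1 H2 !andbT.
  by apply: contraTT H1 => /HS; rewrite orbE orb_rel_sym.
- by rewrite inE /= => /and3P[].
Qed.
Lemma strconst_orb i j k l p q i' j' k' l' p' q' :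
  orb i j = orb i' j' -> orb k l = orb k' l' -> orb p q = orb p' q' ->
  strconst i j k l p q = strconst i' j' k' l' p' q'.
Proof.
move=> Ei Ek /eqP; rewrite orbE => /asboolP[w [e [/= -> ->]]].
rewrite strconst_act /strconst; congr #|` fset_set _|.
by apply/seteqP; split=> s /=; rewrite -!orbE Ei Ek.
Qed.

Definition S22 : Type := {malg rat[orbit]}.
HB.instance Definition _ := GRing.Lmodule.on S22.

HB.lock Definition xi (i j : I2) : S22 := << orb i j >>.

Lemma xi_coef i j x : (xi i j)@_x = (orb i j == x)%:R.
Proof. by rewrite unlock; exact: mcoeffU. Qed.

Definition basis_mul (x y : orbit) : S22 :=
  let: (i, j) := orb_repr x in let: (k, l) := orb_repr y in
  \sum_(z \in [set: orbit])
    (strconst i j k l (orb_repr z).1 (orb_repr z).2)%:R *: (<< z >> : S22).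

HB.lock Definition S22_mul (f g : S22) : S22 :=
  \sum_(x <- msupp f) \sum_(y <- msupp g) (f@_x * g@_y) *: basis_mul x y.


Lemma strconst_supp i j k l p q : strconst i j k l p q != 0%N ->
  exists s, orb p s = orb i j /\ orb s q = orb k l.
Proof.
rewrite /strconst cardfs_eq0 => /fset0Pn[s].
rewrite in_fset_set ?inE /=; last exact: strconst_finite.
by rewrite -!orbE => -[/eqP H1 /eqP H2]; exists s.
Qed.

Lemma basis_mul_finite i j k l :
  finite_set [set z : orbit |
    strconst i j k l (orb_repr z).1 (orb_repr z).2 != 0%N].
Proof.
pose r := [seq orb i q | s <- orb_nbr (orb i j) i, q <- orb_nbr (orb k l) s].
apply: sub_finite_set (finite_seq r) => z /=.
rewrite -{3}[z]orb_reprK; case: (orb_repr z) => p q /=.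
move=> /strconst_supp[s [H1 H2]].
have /eqP := H1; rewrite orbE orb_rel_sym => /asboolP[w [e [/= ei ej]]].
have [e' [eK _]] := aff_actK w e.
have -> : orb p q = orb i (aff_act w e' q) by rewrite -(orb_act w e' p) ei eK.
apply: (@allpairs_f_dep _ _ _ (fun s q => orb i q) _ _ (aff_act w e' s)).
- by rewrite -H1 -(orb_act w e') ei eK mem_orb_nbr.
- by rewrite -H2 -(orb_act w e') mem_orb_nbr.
Qed.

Lemma basis_mulE i j k l p q :
  (basis_mul (orb i j) (orb k l))@_(orb p q) = (strconst i j k l p q)%:R.
Proof.
rewrite /basis_mul.
have := orb_reprK (orb i j); case: (orb_repr (orb i j)) => i' j' /= Ei.
have := orb_reprK (orb k l); case: (orb_repr (orb k l)) => k' l' /= Ek.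
set F := fun z : orbit => _.
have fin := basis_mul_finite i' j' k' l'.
rewrite (fsbigTE (fset_set [set z : orbit |
    strconst i' j' k' l' (orb_repr z).1 (orb_repr z).2 != 0%N])); last first.
  move=> z; rewrite in_fset_set // notin_setE /= => /negP/negPn/eqP->.
  by rewrite scale0r.
rewrite raddf_sum /=.
have -> : strconst i j k l p q = strconst i' j' k' l'
    (orb_repr (orb p q)).1 (orb_repr (orb p q)).2.
  by apply: strconst_orb; rewrite ?orb_reprK.
set A := fset_set _.
rewrite (eq_bigr (fun z => if z == orb p q then (strconst i' j' k' l'
    (orb_repr (orb p q)).1 (orb_repr (orb p q)).2)%:R else 0)); last first.
  move=> z _; rewrite mcoeffZ mcoeffU.
  by case: eqP => [->|_]; rewrite /= ?mulr1n ?mulr0n ?mulr1 ?mulr0.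
have [zA|zA] := boolP (orb p q \in A).
  rewrite (big_fsetD1 _ zA) /= eqxx big1_fset ?addr0 // => z.
  by rewrite !inE => /andP[/negPf-> _].
rewrite big1_seq /=; last first.
  by move=> z zin; case: eqP => // zE; rewrite -zE zin in zA.
by move: zA; rewrite /A in_fset_set // notin_setE /= => /negP/negPn/eqP->.
Qed.

Lemma S22_mulE (f g : S22) p q (S : {fset I2}) :
  (forall s, s \notin S -> f@_(orb p s) = 0) ->
  (S22_mul f g)@_(orb p q) = \sum_(s <- S) f@_(orb p s) * g@_(orb s q).
Proof.
move=> HS; rewrite [S22_mul]unlock /= raddf_sum /=.
have coefE (h : S22) x : h@_x = \sum_(y <- msupp h) h@_y * (x == y)%:R.
  rewrite {1}[h]monalgE raddf_sum; apply: eq_bigr => y _ /=.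
  by rewrite mcoeffU eq_sym; case: eqP; rewrite /= ?mulr1n ?mulr0n ?mulr1 ?mulr0.
under [RHS]eq_bigr => s _ do rewrite (coefE f) (coefE g) big_distrlr /=.
rewrite [RHS]exchange_big /= big_seq [RHS]big_seq.
apply: eq_bigr => x xf; rewrite raddf_sum /= [RHS]exchange_big /=.
apply: eq_bigr => y _; rewrite mcoeffZ.
rewrite -(orb_reprK x) -(orb_reprK y) basis_mulE (@strconstE _ _ _ _ _ _ S).
  rewrite natr_sum mulr_sumr; apply: eq_bigr => s _.
  by rewrite natrM mulrACA.
move=> s /HS fs; rewrite orb_reprK; apply/eqP => E.
by move: xf; rewrite -mcoeff_neq0 -E fs eqxx.
Qed.

Definition S22_one : S22 :=
  xi (1, 1) (1, 1) + xi (1, 2) (1, 2) + xi (2, 2) (2, 2).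

Lemma S22_ext (f g : S22) : (forall p q, f@_(orb p q) = g@_(orb p q)) -> f = g.
Proof. by move=> fg; apply/malgP => x; rewrite -(orb_reprK x). Qed.

(* A finite set containing every [s] with [f@_(orb p s) != 0]. *)
Definition S22_nbr (f : S22) (p : I2) : {fset I2} :=
  [fset s in flatten [seq orb_nbr x p | x <- msupp f]]%fset.

Lemma S22_nbrP f p s : s \notin S22_nbr f p -> f@_(orb p s) = 0.
Proof.
rewrite !inE => H; apply/eqP; move: H; apply: contraR; rewrite mcoeff_neq0 => H.
apply/flattenP; exists (orb_nbr (orb p s) p); last exact: mem_orb_nbr.
exact: (map_f (fun x => orb_nbr x p)).
Qed.

Lemma S22_mulA : associative S22_mul.
Proof.
move=> f g h; apply: S22_ext => p q.
pose S := S22_nbr f p.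
pose T := (S22_nbr (S22_mul f g) p `|` \bigcup_(s <- S) S22_nbr g s)%fset.
rewrite (@S22_mulE _ _ p q S); last exact: S22_nbrP.
rewrite (@S22_mulE _ _ p q T); last first.
  by move=> s; rewrite inE negb_or => /andP[/S22_nbrP].
transitivity (\sum_(s <- S) \sum_(t <- T)
    f@_(orb p s) * g@_(orb s t) * h@_(orb t q)).
  rewrite big_seq [RHS]big_seq; apply: eq_bigr => s sS.
  rewrite (@S22_mulE _ _ s q T) ?mulr_sumr; first last.
    move=> t tT; apply: S22_nbrP; apply: contra tT => tg.
    by rewrite inE; apply/orP; right; apply/bigfcupP; exists s; rewrite ?sS.
  by apply: eq_bigr => t _; rewrite mulrA.
rewrite exchange_big /=; apply: eq_bigr => t _.
by rewrite (@S22_mulE _ _ p t S) ?mulr_suml //; exact: S22_nbrP.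
Qed.

Lemma orb_diag i p q : (orb p q == orb i i) = (p == q) && (orb p p == orb i i).
Proof.
apply/idP/andP => [|[/eqP<-//]].
rewrite eq_sym orbE => /asboolP[w [e [/= -> ->]]].
by rewrite orb_act !eqxx.
Qed.

Lemma orb_diagE (p i : I2) : (orb i i == orb p p) =
  (((p.1 %% 2)%Z + (p.2 %% 2)%Z) == ((i.1 %% 2)%Z + (i.2 %% 2)%Z)).
Proof.
case: p i => [a b] [c d] /=; rewrite orbE; apply/asboolP/eqP.
  case=> w [[e e'] /= [] ]; rewrite /aff_act !mulr2n => H _; move: H.
  by case: w => -[] /= ? ?; lia.
move=> E; have [ac|ac] := eqVneq (a %% 2)%Z (c %% 2)%Z.
  exists false, (((a - c) %/ 2)%Z, ((b - d) %/ 2)%Z).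
  by rewrite /aff_act !mulr2n /=; congr ((_, _), (_, _)) => /=; lia.
exists true, (((a - d) %/ 2)%Z, ((b - c) %/ 2)%Z).
by rewrite /aff_act !mulr2n /=; congr ((_, _), (_, _)) => /=; lia.
Qed.

Lemma S22_oneE p q : S22_one@_(orb p q) = (p == q)%:R.
Proof.
rewrite !mcoeffD !xi_coef ![_ == orb p q]eq_sym (orb_diag (1, 1)).
rewrite (orb_diag (1, 2)) (orb_diag (2, 2)); case: eqP => //= _.
rewrite ![orb p p == _]eq_sym !orb_diagE.
have : ((p.1 %% 2)%Z + (p.2 %% 2)%Z) = 0
  \/ ((p.1 %% 2)%Z + (p.2 %% 2)%Z) = 1 \/ ((p.1 %% 2)%Z + (p.2 %% 2)%Z) = 2.
  by lia.
by case=> [|[|]] ->.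
Qed.

Lemma S22_mul1 : left_id S22_one S22_mul.
Proof.
move=> f; apply: S22_ext => p q; rewrite (@S22_mulE _ _ p q [fset p]%fset).
  by rewrite big_seq_fset1 S22_oneE eqxx mul1r.
by move=> s; rewrite inE S22_oneE eq_sym => /negPf->.
Qed.

Lemma S22_mulr1 : right_id S22_one S22_mul.
Proof.
move=> f; apply: S22_ext => p q.
rewrite (@S22_mulE _ _ p q (q |` S22_nbr f p)%fset); last first.
  by move=> s; rewrite in_fset1U negb_or => /andP[_ /S22_nbrP].
rewrite (big_fsetD1 q) ?in_fset1U ?eqxx //= S22_oneE eqxx mulr1 big1_fset ?addr0 //.
by move=> s; rewrite in_fsetD1 => /andP[/negPf sq _] _; rewrite S22_oneE sq mulr0.
Qed.

Lemma S22_mulDl : left_distributive S22_mul +%R.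
Proof.
move=> f g h; apply: S22_ext => p q.
pose S := (S22_nbr f p `|` S22_nbr g p)%fset.
have Sf s : s \notin S -> f@_(orb p s) = 0.
  by rewrite inE negb_or => /andP[/S22_nbrP].
have Sg s : s \notin S -> g@_(orb p s) = 0.
  by rewrite inE negb_or => /andP[_ /S22_nbrP].
rewrite mcoeffD !(@S22_mulE _ _ p q S) //.
  by rewrite -big_split; apply: eq_bigr => s _ /=; rewrite mcoeffD mulrDl.
by move=> s sS; rewrite mcoeffD Sf ?Sg ?addr0.
Qed.

Lemma S22_mulDr : right_distributive S22_mul +%R.
Proof.
move=> f g h; apply: S22_ext => p q; have Sf := @S22_nbrP f p.
rewrite mcoeffD !(@S22_mulE _ _ p q (S22_nbr f p)) // -big_split.
by apply: eq_bigr => s _ /=; rewrite mcoeffD mulrDr.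
Qed.

Lemma S22_one_neq0 : S22_one != 0.
Proof.
apply/eqP => /(congr1 (fun f : S22 => f@_(orb 0 0))) /eqP.
by rewrite S22_oneE mcoeff0.
Qed.

HB.instance Definition _ := GRing.Zmodule_isNzRing.Build S22
  S22_mulA S22_mul1 S22_mulr1 S22_mulDl S22_mulDr S22_one_neq0.

Lemma S22_scaleAl (a : rat) (f g : S22) : a *: (f * g) = (a *: f) * g.
Proof.
apply: S22_ext => p q; have Sf := @S22_nbrP f p.
rewrite mcoeffZ !(@S22_mulE _ _ p q (S22_nbr f p)) //.
  by rewrite mulr_sumr; apply: eq_bigr => s _; rewrite mcoeffZ mulrA.
by move=> s /Sf fs; rewrite mcoeffZ fs mulr0.
Qed.

HB.instance Definition _ := GRing.Lmodule_isLalgebra.Build rat S22 S22_scaleAl.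

Lemma S22_scaleAr (a : rat) (f g : S22) : a *: (f * g) = f * (a *: g).
Proof.
apply: S22_ext => p q; have Sf := @S22_nbrP f p.
rewrite mcoeffZ !(@S22_mulE _ _ p q (S22_nbr f p)) //.
by rewrite mulr_sumr; apply: eq_bigr => s _; rewrite mcoeffZ mulrCA.
Qed.

HB.instance Definition _ := GRing.Lalgebra_isAlgebra.Build rat S22 S22_scaleAr.

Lemma xi_eq i j k l : xi i j = xi k l <-> orb_rel (i, j) (k, l).
Proof.
rewrite -orbE; split=> [E|/eqP E]; last by rewrite unlock E.
have /eqP := congr1 (fun f : S22 => f@_(orb i j)) E.
by rewrite !xi_coef eqxx [orb k l == _]eq_sym; case: (_ == orb k l).
Qed.

Lemma xi_mul i j k l : xi i j * xi k l =
  \sum_(z \in [set: orbit])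
    (strconst i j k l (orb_repr z).1 (orb_repr z).2)%:R
      *: xi (orb_repr z).1 (orb_repr z).2.
Proof.
transitivity (basis_mul (orb i j) (orb k l)).
  have suppE p q : msupp (xi p q) = [fset orb p q]%fset by rewrite unlock; exact: msuppU.
  transitivity (S22_mul (xi i j) (xi k l)); first by [].
  by rewrite unlock !suppE !big_seq_fset1 !xi_coef !eqxx mulr1 scale1r.
rewrite /basis_mul; case Ei: (orb_repr (orb i j)) => [i' j'].
case Ek: (orb_repr (orb k l)) => [k' l'].
apply: eq_fsbigr => z _; rewrite [xi]unlock orb_reprK; congr (_%:R *: _).
by apply: strconst_orb => //; rewrite -[RHS]orb_reprK ?Ei ?Ek.
Qed.

(** * Affine cellular algebras *)

(* The ground ring [k] is only used at the field of rationals, so the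
   noetherian hypothesis on the domain [k] is omitted. *)

Section Affine.
Import mpoly.

Definition affine_algebra (k : idomainType) (B : comAlgType k) : Prop :=
  exists (t : nat) (phi : {lrmorphism {mpoly k[t]} -> B}), range phi = setT.

End Affine.

Section Modules.
Variable k : idomainType.

Record kinvolution (A : algType k) (tau : A -> A) : Prop := {
  kinvolution_linear : linear tau;
  kinvolution_anti : forall x y, tau (x * y) = tau y * tau x;
  kinvolution_invol : involutive tau }.

Record submodule (M : lmodType k) (N : set M) : Prop := {
  submodule0 : N 0;
  submodule_linear : forall c x y, N x -> N y -> N (c *: x + y) }.

Record two_sided_ideal (A : algType k) (J : set A) : Prop := {
  ideal_submodule : submodule J;
  ideal_mull : forall a x, J x -> J (a * x);
  ideal_mulr : forall a x, J x -> J (x * a) }.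

Record bilinear_map (M N P : lmodType k) (f : M -> N -> P) : Prop := {
  bilinear_l : forall n, linear (f^~ n);
  bilinear_r : forall m, linear (f m) }.

Record left_action (R : algType k) (M : lmodType k) (act : R -> M -> M) :
    Prop := {
  left_action_bilinear : bilinear_map act;
  left_action1 : forall m, act 1 m = m;
  left_actionM : forall a b m, act (a * b) m = act a (act b m) }.

Record right_action (R : algType k) (M : lmodType k) (act : M -> R -> M) :
    Prop := {
  right_action_bilinear : bilinear_map act;
  right_action1 : forall m, act m 1 = m;
  right_actionM : forall a b m, act m (a * b) = act (act m a) b }.

Record bimodule (R S : algType k) (M : lmodType k)
    (lact : R -> M -> M) (ract : M -> S -> M) : Prop := {
  bimodule_l : left_action lact;
  bimodule_r : right_action ract;
  bimoduleC : forall a m b, ract (lact a m) b = lact a (ract m b) }.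

Record balanced_map (R : Type) (M N : lmodType k)
    (ract : M -> R -> M) (lact : R -> N -> N)
    (P : lmodType k) (f : M -> N -> P) : Prop := {
  balanced_bilinear : bilinear_map f;
  balancedP : forall m b n, f (ract m b) n = f m (lact b n) }.

(* [(T, t)] is the tensor product of the right [R]-module [M] and the left
   [R]-module [N], by its universal property. *)
Record tensor_product (R : Type) (M N : lmodType k)
    (ract : M -> R -> M) (lact : R -> N -> N)
    (T : lmodType k) (t : M -> N -> T) : Prop := {
  tensor_balanced : balanced_map ract lact t;
  tensor_universal : forall (P : lmodType k) (f : M -> N -> P),
    balanced_map ract lact f ->
    exists2 g : {linear T -> P}, (forall m n, g (t m n) = f m n)
      & forall g' : {linear T -> P}, (forall m n, g' (t m n) = f m n) -> g' =1 g
  }.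

Definition tensor_product_k (M N T : lmodType k) (t : M -> N -> T) : Prop :=
  tensor_product (fun m (c : k) => c *: m) (fun (c : k) n => c *: n) t.

(* The free module V of finite rank is a [vectType], and every tensor product is
   given by its universal property; [cell_switch], the two actions on
   [cell_T] and [cell_f] are then determined by their values on pure tensors.
   In the names of the fields, [D] is the bimodule written as a triangle, [D']
   the primed one, and [T] their tensor product over [B]. *)
Record affine_cell_datum (A : algType k) (tau : A -> A) (J : set A) := {
  cell_V : vectType k;
  cell_B : comAlgType k;
  cell_B_affine : affine_algebra cell_B;
  cell_sigma : cell_B -> cell_B;
  cell_sigma_invol : kinvolution cell_sigma;

  cell_D : lmodType k;
  cell_tens : cell_V -> cell_B -> cell_D;
  cell_tensP : tensor_product_k cell_tens;
  cell_lact : A -> cell_D -> cell_D;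
  cell_ract : cell_D -> cell_B -> cell_D;
  cell_bimodule : bimodule cell_lact cell_ract;
  cell_ractE : forall v b b',
    cell_ract (cell_tens v b) b' = cell_tens v (b * b');

  cell_D' : lmodType k;
  cell_tens' : cell_B -> cell_V -> cell_D';
  cell_tensP' : tensor_product_k cell_tens';
  cell_switch : {linear cell_D -> cell_D'};
  cell_switchE : forall v b, cell_switch (cell_tens v b) = cell_tens' b v;
  cell_lact' : cell_B -> cell_D' -> cell_D';
  cell_ract' : cell_D' -> A -> cell_D';
  cell_bimodule' : bimodule cell_lact' cell_ract';
  cell_lactE' : forall b b' v,
    cell_lact' b (cell_tens' b' v) = cell_tens' (b * b') v;
  cell_ractE' : forall b v a,
    cell_ract' (cell_tens' b v) a
      = cell_switch (cell_lact (tau a) (cell_tens v b));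

  cell_T : lmodType k;
  cell_tensB : cell_D -> cell_D' -> cell_T;
  cell_tensBP : tensor_product cell_ract cell_lact' cell_tensB;
  cell_lactT : A -> cell_T -> cell_T;
  cell_ractT : cell_T -> A -> cell_T;
  cell_bimoduleT : bimodule cell_lactT cell_ractT;
  cell_lactTE : forall a x y,
    cell_lactT a (cell_tensB x y) = cell_tensB (cell_lact a x) y;
  cell_ractTE : forall x y a,
    cell_ractT (cell_tensB x y) a = cell_tensB x (cell_ract' y a);

  (* Only the values of [cell_alpha] on [J] matter. *)
  cell_alpha : A -> cell_T;
  cell_alpha_linear : forall c x y, J x -> J y ->
    cell_alpha (c *: x + y) = c *: cell_alpha x + cell_alpha y;
  cell_alpha_l : forall a x, J x ->
    cell_alpha (a * x) = cell_lactT a (cell_alpha x);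
  cell_alpha_r : forall a x, J x ->
    cell_alpha (x * a) = cell_ractT (cell_alpha x) a;
  cell_alpha_bij : set_bij J setT cell_alpha;

  cell_f : {linear cell_T -> cell_T};
  cell_fE : forall v1 b1 b2 v2,
    cell_f (cell_tensB (cell_tens v1 b1) (cell_tens' b2 v2))
      = cell_tensB (cell_tens v2 (cell_sigma b2))
                   (cell_tens' (cell_sigma b1) v1);
  cell_alpha_tau : forall x, J x -> cell_alpha (tau x) = cell_f (cell_alpha x)
}.

Definition affine_cell_ideal (A : algType k) (tau : A -> A) (J : set A) :
    Prop :=
  [/\ two_sided_ideal J, tau @` J = J & inhabited (affine_cell_datum tau J)].

(* [pi] presents [Q] as the quotient algebra of [A] by [I]. As an [algType] is
   a nontrivial ring, [I] is then proper. *)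
Definition quotient_map (A Q : algType k) (I : set A)
    (pi : {lrmorphism A -> Q}) : Prop :=
  range pi = setT /\ pi @^-1` [set 0] = I.

Definition layer (A : algType k) (n : nat) (J' : 'I_n -> set A) (i : nat) :
    set A :=
  [set a | exists2 x : 'I_n -> A, (forall l, J' l (x l))
                                & a = \sum_(l < n | (l < i)%N) x l].

Definition direct_decomposition (A : algType k) (n : nat)
    (J' : 'I_n -> set A) : Prop :=
  (forall j, submodule (J' j)) /\
  forall a : A, exists! x : {ffun 'I_n -> A},
    (forall l, J' l (x l)) /\ a = \sum_(l < n) x l.

(* The chain of ideals is strict before its last term, in that J_j is proper for
   j < n; repeated terms J_j = A can be dropped from a chain without loss.
   With [j : 'I_n] counted from 0, [layer J' j] is the ideal J_j and
   [layer J' j.+1] is J_{j+1}, the sum of J'_1, ..., J'_{j+1}. *)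
Definition affine_cellular (A : algType k) (tau : A -> A) : Prop :=
  exists (n : nat) (J' : 'I_n -> set A),
    [/\ direct_decomposition J',
        forall j, tau @` J' j = J' j,
        forall i, (i <= n)%N -> two_sided_ideal (layer J' i)
      & forall j : 'I_n,
          exists (Q : algType k) (pi : {lrmorphism A -> Q}) (tauQ : Q -> Q),
            [/\ quotient_map (layer J' j) pi,
                kinvolution tauQ,
                forall a, tauQ (pi a) = pi (tau a)
              & affine_cell_ideal tauQ (pi @` layer J' j.+1)]].

End Modules.

(* Main.v *)
Require Import Defs.
From HB Require Import structures.
From mathcomp Require Import all_boot all_order all_algebra.
From mathcomp Require Import finmap boolp classical_sets monalg zify ring.

(* Let R = Q[x1, 1/x1, x2, 1/x2], let s be the swap of x1 and x2, and B = R^s.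
   Grouping the points of Z^2 by their residues modulo 2 identifies S(2,2) with the 4 x 4
   matrices over R that are fixed by s combined with the transposition of the
   residues (0,1) and (1,0).  The transpose is then an involution fixing the
   scalars of B.  Since R = B + x1 B is free over B, the s-fixed column vectors
   have a B-basis, the columns of a matrix P, and P N P^T, for N in M_4(B), runs
   over an ideal isomorphic to M_4(B) as a bimodule: a cell ideal with trivial
   sigma.  A matrix M has this form exactly when M_22 - M_23 is divisible by
   x1 - x2, that is, when M is killed by the morphism onto Q[t, 1/t] which sends M to
   M_22 - M_23 at x1 = x2 = t; so the quotient is Q[t, 1/t], itself a cell ideal of
   rank one.  Diagonal matrices give a complement fixed by the transpose. *)

Set Implicit Arguments.
Unset Strict Implicit.
Unset Printing Implicit Defensive.

Import Order.TTheory GRing.Theory Num.Theory.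
Local Open Scope ring_scope.

(** * Group algebras of abelian groups *)

Section LinearExtension.
Variables (k : comNzRingType) (K : choiceType).

Lemma malg_ind (P : {malg k[K]} -> Prop) :
  P 0 -> (forall c f g, P f -> P g -> P (c *: f + g)) ->
  (forall x, P << x >>) -> forall f, P f.
Proof.
move=> P0 PZD PU f; rewrite [f]monalgE; elim/big_ind: _ => // [g h Pg Ph|x _].
  by rewrite -[g]scale1r; apply: PZD.
suff -> : << f@_x *g x >> = f@_x *: << x >> + 0 :> {malg k[K]} by apply: PZD.
by apply/malgP => y; rewrite addr0 mcoeffZ !mcoeffU mulrnAr mulr1.
Qed.

Variables (M : lmodType k).

Definition lext (h : K -> M) (f : {malg k[K]}) : M :=
  \sum_(x <- msupp f) f@_x *: h x.

Lemma lextEw h f (D : {fset K}) : (forall x, x \notin D -> f@_x = 0) ->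
  lext h f = \sum_(x <- D) f@_x *: h x.
Proof.
move=> fD; rewrite /lext; apply: big_fset_incl.
  by apply/fsubsetP => x; apply: contraLR => /fD/eqP; rewrite mcoeff_eq0.
by move=> x _ /mcoeff_outdom ->; rewrite scale0r.
Qed.

Lemma lext_is_linear h : linear (lext h).
Proof.
move=> c f g; pose D := (msupp f `|` msupp g)%fset.
have outD x : x \notin D -> f@_x = 0 /\ g@_x = 0.
  by rewrite in_fsetU negb_or => /andP[/mcoeff_outdom-> /mcoeff_outdom->].
rewrite (@lextEw _ f D) => [|x /outD[]//].
rewrite (@lextEw _ g D) => [|x /outD[]//].
rewrite (@lextEw _ _ D) => [|x /outD[fx gx]]; last first.
  by rewrite mcoeffD mcoeffZ fx gx mulr0 addr0.
rewrite scaler_sumr -big_split; apply: eq_bigr => x _ /=.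
by rewrite mcoeffD mcoeffZ scalerDl scalerA.
Qed.

HB.instance Definition _ h := GRing.isLinear.Build k {malg k[K]} M *:%R (lext h)
  (lext_is_linear h).

Lemma lextU h x : lext h << x >> = h x.
Proof. by rewrite /lext msuppU oner_eq0 big_seq_fset1 mcoeffUU scale1r. Qed.

Lemma linear_ext (f g : {linear {malg k[K]} -> M}) :
  (forall x, f << x >> = g << x >>) -> f =1 g.
Proof.
move=> fg; apply: malg_ind => [|c u v fu fv|x]; first by rewrite !linear0.
  by rewrite !linearP fu fv.
exact: fg.
Qed.

End LinearExtension.

(* [monalg] multiplies only over a [monomType], which excludes the infinite
   groups needed for Laurent polynomials. *)
Definition galg (k : comNzRingType) (G : zmodType) : Type := {malg k[G]}.

HB.instance Definition _ k G := GRing.Lmodule.on (galg k G).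

Definition gmon (k : comNzRingType) (G : zmodType) (x : G) : galg k G := << x >>.

HB.lock Definition galg_mul (k : comNzRingType) (G : zmodType) (f g : galg k G) :
    galg k G :=
  lext (fun x => lext (fun y => gmon k (x + y)) g : galg k G) f.

Section GroupAlgebra.
Variables (k : comNzRingType) (G : zmodType).
Local Notation A := (galg k G).
Implicit Types (f g h : A).

Lemma galg_ind (P : A -> Prop) :
  P 0 -> (forall c f g, P f -> P g -> P (c *: f + g)) ->
  (forall x : G, P (gmon k x)) -> forall f, P f.
Proof. exact: malg_ind. Qed.

Lemma galg_mulU (x y : G) : galg_mul (gmon k x) (gmon k y) = gmon k (x + y).
Proof. by rewrite unlock !lextU. Qed.

Lemma galg_mulC : commutative (@galg_mul k G).
Proof.
move=> f g; rewrite unlock /lext; under eq_bigr do rewrite scaler_sumr.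
rewrite exchange_big /=; apply: eq_bigr => y _; rewrite scaler_sumr.
by apply: eq_bigr => x _; rewrite !scalerA mulrC addrC.
Qed.

Lemma galg_mulPl c f g h :
  galg_mul (c *: f + g) h = c *: galg_mul f h + galg_mul g h.
Proof. by rewrite unlock; exact: lext_is_linear. Qed.

Lemma galg_mulPr c f g h :
  galg_mul h (c *: f + g) = c *: galg_mul h f + galg_mul h g.
Proof. by rewrite ![galg_mul h _]galg_mulC galg_mulPl. Qed.

Lemma galg_mul0r f : galg_mul 0 f = 0.
Proof. by rewrite unlock linear0. Qed.

Lemma galg_mulr0 f : galg_mul f 0 = 0.
Proof. by rewrite galg_mulC galg_mul0r. Qed.

Lemma galg_mulA : associative (@galg_mul k G).
Proof.
move=> f g h; elim/galg_ind: f => [|c u v IHu IHv|x]; first by rewrite !galg_mul0r.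
  by rewrite !galg_mulPl IHu IHv.
elim/galg_ind: g => [|c u v IHu IHv|y].
- by rewrite galg_mul0r galg_mulr0 galg_mul0r.
- by rewrite galg_mulPl !galg_mulPr galg_mulPl IHu IHv.
elim/galg_ind: h => [|c u v IHu IHv|z]; first by rewrite !galg_mulr0.
  by rewrite !galg_mulPr IHu IHv.
by rewrite !galg_mulU addrA.
Qed.

Lemma galg_mul1 : left_id (gmon k (0 : G)) (@galg_mul k G).
Proof.
elim/galg_ind => [|c u v IHu IHv|x]; first by rewrite galg_mulr0.
  by rewrite galg_mulPr IHu IHv.
by rewrite galg_mulU add0r.
Qed.

Lemma galg_mulDl : left_distributive (@galg_mul k G) +%R.
Proof. by move=> f g h; rewrite -[f]scale1r galg_mulPl !scale1r. Qed.

Lemma galg_one_neq0 : gmon k (0 : G) != 0 :> A.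
Proof. by rewrite /gmon monalgU_eq0 oner_neq0. Qed.

HB.instance Definition _ := GRing.Zmodule_isComNzRing.Build A
  galg_mulA galg_mulC galg_mul1 galg_mulDl galg_one_neq0.

Lemma galg_scaleAl (c : k) f g : c *: (f * g) = (c *: f) * g.
Proof. by rewrite -[c *: f]addr0 [RHS]galg_mulPl galg_mul0r addr0. Qed.

HB.instance Definition _ := GRing.Lmodule_isLalgebra.Build k A galg_scaleAl.
HB.instance Definition _ := GRing.Lalgebra_isComAlgebra.Build k A.

Lemma gmonD (x y : G) : gmon k (x + y) = gmon k x * gmon k y.
Proof. exact/esym/galg_mulU. Qed.

Lemma gmon0 : gmon k (0 : G) = 1.
Proof. by []. Qed.

Lemma gmonMn (x : G) n : gmon k (x *+ n) = gmon k x ^+ n.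
Proof. by elim: n => // n IHn; rewrite mulrS exprS gmonD IHn. Qed.

Lemma gmon_coef (x y : G) : (gmon k x)@_y = (x == y)%:R.
Proof. exact: mcoeffU. Qed.

Lemma galg_ext f g : (forall x, f@_x = g@_x) -> f = g.
Proof. by move=> fg; apply/malgP. Qed.

Lemma galg_mulE f g : f * g = lext (fun x => gmon k x * g) f.
Proof.
elim/galg_ind: f => [|c u v IHu IHv|x]; first by rewrite mul0r linear0.
  by rewrite mulrDl -scalerAl linearP IHu IHv.
by rewrite lextU.
Qed.

(** The product as a convolution. [D] is free to be any finite set carrying [f], as in [S22_mulE],
    so that the two products can be compared term by term. *)
Lemma gmulE f g (D : {fset G}) e : (forall x, x \notin D -> f@_x = 0) ->
  (f * g)@_e = \sum_(d <- D) f@_d * g@_(e - d).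
Proof.
move=> fD; have -> : f * g = \sum_(d <- D) f@_d *: (gmon k d * g).
  by rewrite galg_mulE; exact: lextEw.
rewrite raddf_sum; apply: eq_bigr => d _ /=.
rewrite mcoeffZ; congr (_ * _); elim/galg_ind: g => [|c u v IHu IHv|y].
- by rewrite mulr0 !mcoeff0.
- by rewrite mulrDr -scalerAr !mcoeffD !mcoeffZ IHu IHv.
by rewrite -gmonD !gmon_coef [y == _]eq_sym subr_eq eq_sym addrC.
Qed.

Lemma gmonM_coef (x : G) f e : (gmon k x * f)@_e = f@_(e - x).
Proof.
rewrite (@gmulE _ _ [fset x]%fset) ?big_seq_fset1 ?gmon_coef ?eqxx ?mul1r //.
by move=> y; rewrite inE eq_sym gmon_coef => /negPf->.
Qed.

End GroupAlgebra.

(** * Functoriality of group algebras *)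

Section Pushforward.
Variables (k : comNzRingType) (G H : zmodType) (phi : {additive G -> H}).

Definition gmap (f : galg k G) : galg k H := lext (fun x => gmon k (phi x)) f.

Lemma gmap_is_linear : linear gmap.
Proof. exact: lext_is_linear. Qed.

HB.instance Definition _ := GRing.isLinear.Build k (galg k G) (galg k H) *:%R gmap
  gmap_is_linear.

Lemma gmapU x : gmap (gmon k x) = gmon k (phi x).
Proof. exact: lextU. Qed.

Lemma gmap_is_monoid_morphism : monoid_morphism gmap.
Proof.
split=> [|f g]; first by rewrite -(gmon0 k G) gmapU raddf0.
elim/galg_ind: f => [|c u v IHu IHv|x]; first by rewrite mul0r raddf0 mul0r.
  by rewrite mulrDl -scalerAl !gmap_is_linear mulrDl -scalerAl IHu IHv.
elim/galg_ind: g => [|c u v IHu IHv|y]; first by rewrite mulr0 raddf0 mulr0.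
  by rewrite mulrDr -scalerAr !gmap_is_linear mulrDr -scalerAr IHu IHv.
by rewrite -gmonD !gmapU raddfD gmonD.
Qed.

HB.instance Definition _ := GRing.isMonoidMorphism.Build (galg k G) (galg k H)
  gmap gmap_is_monoid_morphism.

End Pushforward.

Arguments gmap k {G H} phi f.

(** * A matrix criterion for affine cell ideals *)

Section PolynomialEvaluation.
Variables (k : idomainType) (B : comAlgType k) (t : nat) (h : 'I_t -> B).

Definition cmon_eval (m : cmonom 'I_t) : B := \prod_i h i ^+ m i.

Lemma cmon_eval_mmorphism : mmorphism cmon_eval.
Proof.
split=> [m1 m2|]; last by apply: big1 => i _; rewrite cm1.
by rewrite -big_split; apply: eq_bigr => i _; rewrite cmM exprD.
Qed.

HB.instance Definition _ := isMultiplicative.Build _ _ cmon_eval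
  cmon_eval_mmorphism.

Definition mpeval (p : {mpoly k[t]}) : B := mmap (in_alg B) cmon_eval p.

Lemma mpeval_additive : additive mpeval.
Proof. exact: mmap_is_additive. Qed.

Lemma mpeval_monoid_morphism : monoid_morphism mpeval.
Proof.
by have [mulE oneE] := @mmap_is_multiplicative _ _ _ (in_alg B) cmon_eval.
Qed.

HB.instance Definition _ := GRing.isAdditive.Build {mpoly k[t]} B mpeval
  mpeval_additive.
HB.instance Definition _ := GRing.isMonoidMorphism.Build {mpoly k[t]} B mpeval
  mpeval_monoid_morphism.

Lemma mpeval_scalable : scalable mpeval.
Proof. by move=> c p; rewrite /mpeval mmapZ mulr_algl. Qed.

HB.instance Definition _ := GRing.isScalable.Build k {mpoly k[t]} B *:%R mpeval
  mpeval_scalable.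

(** Generation is phrased as an induction principle; applied to the range of the evaluation map, it
    says that this map is onto. *)
Lemma affine_algebra_generated :
  (forall P : B -> Prop, P 1 -> (forall i, P (h i)) ->
    (forall c x y, P x -> P y -> P (c *: x + y)) ->
    (forall x y, P x -> P y -> P (x * y)) -> forall b, P b) ->
  affine_algebra B.
Proof.
move=> gen; exists t, mpeval; apply/seteqP; split=> // b _.
apply: (gen (range mpeval)) => [|i|c x y [p _ <-] [q _ <-]|x y [p _ <-] [q _ <-]].
- by exists 1 => //; rewrite rmorph1.
- exists << ucm i >> => //; rewrite /mpeval mmapU /= scale1r mul1r /cmon_eval.
  rewrite (bigD1 i) //= cmUU big1 ?mulr1 // => j /negPf ji.
  by rewrite cmU eq_sym ji.
- by exists (c *: p + q) => //; rewrite linearP.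
- by exists (p * q) => //; rewrite rmorphM.
Qed.

End PolynomialEvaluation.

(* Matrices over [B] as a module over the ground ring [k] instead of [B]. *)
Definition kmx (k : comNzRingType) (B : comAlgType k) (m n : nat) : Type :=
  'M[B]_(m, n).

Section ScalarRestriction.
Variables (k : comNzRingType) (B : comAlgType k) (m n : nat).
Local Notation M := (kmx B m n).

HB.instance Definition _ := GRing.Zmodule.on M.

Definition kmx_scale (c : k) (X : M) : M := map_mx (fun b : B => c *: b) X.

Lemma kmx_scaleA c d X : kmx_scale c (kmx_scale d X) = kmx_scale (c * d) X.
Proof. by apply/matrixP => i j; rewrite !mxE scalerA. Qed.

Lemma kmx_scale1 : left_id 1 kmx_scale.
Proof. by move=> X; apply/matrixP => i j; rewrite !mxE scale1r. Qed.

Lemma kmx_scaleDr : right_distributive kmx_scale +%R.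
Proof. by move=> c X Y; apply/matrixP => i j; rewrite !mxE scalerDr. Qed.

Lemma kmx_scaleDl X : {morph kmx_scale^~ X : c d / c + d}.
Proof. by move=> c d; apply/matrixP => i j; rewrite !mxE scalerDl. Qed.

HB.instance Definition _ := GRing.Zmodule_isLmodule.Build k M
  kmx_scaleA kmx_scale1 kmx_scaleDr kmx_scaleDl.

Lemma kmxZ c (X : M) i j : (c *: X) i j = c *: X i j.
Proof. by rewrite [LHS]mxE. Qed.

Lemma kmxD (X Y : M) i j : (X + Y) i j = X i j + Y i j.
Proof. by rewrite [LHS]mxE. Qed.

Lemma kmx_sum (I : Type) (r : seq I) (F : I -> M) i j :
  (\sum_(l <- r) F l) i j = \sum_(l <- r) F l i j.
Proof. exact: (@summxE B m n). Qed.

End ScalarRestriction.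

Section KmxBilinear.
Variables (k : comNzRingType) (B : comAlgType k).

Lemma kmxMPl m n p c (X Y : kmx B m n) (Z : kmx B n p) :
  (c *: X + Y) *m Z = c *: (X *m Z : kmx B m p) + (Y *m Z : kmx B m p).
Proof.
apply/matrixP => i j; rewrite kmxD kmxZ !mxE scaler_sumr -big_split.
by apply: eq_bigr => l _; rewrite kmxD kmxZ mulrDl scalerAl.
Qed.

Lemma kmxMPr m n p c (X Y : kmx B n p) (Z : kmx B m n) :
  Z *m (c *: X + Y) = c *: (Z *m X : kmx B m p) + (Z *m Y : kmx B m p).
Proof.
apply/matrixP => i j; rewrite kmxD kmxZ !mxE scaler_sumr -big_split.
by apply: eq_bigr => l _; rewrite kmxD kmxZ mulrDr scalerAr.
Qed.

Lemma kmx_trP m n c (X Y : kmx B m n) :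
  (c *: X + Y)^T = c *: (X^T : kmx B n m) + (Y^T : kmx B n m).
Proof. by apply/matrixP => i j; rewrite kmxD kmxZ !mxE. Qed.

Definition kmx_tr m n (X : kmx B m n) : kmx B n m := X^T.

HB.instance Definition _ m n := GRing.isLinear.Build k (kmx B m n) (kmx B n m)
  *:%R (@kmx_tr m n) (@kmx_trP m n).

End KmxBilinear.

Lemma linear_range_submodule (k : idomainType) (M N : lmodType k) (f : M -> N) :
  linear f -> submodule (range f).
Proof.
move=> f_lin; split=> [|c x y [u _ <-] [v _ <-]]; last first.
  by exists (c *: u + v); rewrite ?f_lin.
by exists 0 => //; have := f_lin (-1) 0 0; rewrite scaler0 addr0 scaleN1r addNr.
Qed.

(** * Ideals parametrized by matrices over an affine algebra *)

Section Criterion.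
Variables (k : idomainType) (A : algType k) (tau : A -> A) (B : comAlgType k).
Variables (n : nat) (rho : A -> kmx B n n) (beta : kmx B n n -> A).
Hypothesis B_affine : affine_algebra B.
Hypothesis tau_invol : kinvolution tau.
Hypothesis rho_linear : linear rho.
Hypothesis rho1 : rho 1 = 1%:M.
Hypothesis rhoM : forall a b, rho (a * b) = rho a *m rho b.
Hypothesis beta_linear : linear beta.
Hypothesis beta_inj : injective beta.
Hypothesis beta_mull : forall a X, a * beta X = beta (rho a *m X).
Hypothesis tau_beta : forall X, tau (beta X) = beta X^T.

Local Notation V := 'rV[k]_n.
Local Notation D := (kmx B n 1).
Local Notation D' := (kmx B 1 n).
Local Notation T := (kmx B n n).

Definition mx_tens (v : V) (b : B) : D := \col_i (v 0 i *: b).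
Definition mx_tens' (b : B) (v : V) : D' := \row_i (v 0 i *: b).

Lemma mx_tens_expand (x : D) : x = \sum_i mx_tens (delta_mx 0 i) (x i 0).
Proof.
apply/matrixP => i j; rewrite kmx_sum (bigD1 i) //= big1 => [|l /negPf li].
  by rewrite ord1 !mxE !eqxx scale1r addr0.
by rewrite !mxE eqxx [i == l]eq_sym li scale0r.
Qed.

Lemma mx_tens_bilinear : bilinear_map mx_tens.
Proof.
split=> [b c v w|v c b b']; apply/matrixP => i j; rewrite kmxD kmxZ !mxE.
  by rewrite scalerDl scalerA.
by rewrite scalerDr !scalerA mulrC.
Qed.

(** A column x is the sum of the tensors of e_i with x_i, so the induced map can only be the sum of
    the f(e_i, x_i); expanding v in the standard basis shows that it extends f. *)
Lemma mx_tensP : tensor_product_k mx_tens.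
Proof.
split=> [|P f [[fl fr] fb]].
  split=> [|v c b]; first exact: mx_tens_bilinear.
  by apply/matrixP => i j; rewrite !mxE scalerA mulrC.
pose g (x : D) := \sum_i f (delta_mx 0 i) (x i 0).
have g_linear : linear g.
  move=> c x y; rewrite /g scaler_sumr -big_split; apply: eq_bigr => i _ /=.
  by rewrite kmxD kmxZ fr.
pose f' b := HB.pack (f^~ b) (GRing.isLinear.Build _ _ _ _ (f^~ b) (fl b))
  : {linear V -> P}.
pose G := HB.pack g (GRing.isLinear.Build _ _ _ _ g g_linear) : {linear D -> P}.
exists G => [v b|h hE x].
  rewrite /= /g.
  transitivity (f' b (\sum_i v 0 i *: delta_mx 0 i)); last by rewrite -row_sum_delta.
  rewrite linear_sum; apply: eq_bigr => i _.
  by rewrite mxE; exact/esym/fb.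
rewrite [in LHS](mx_tens_expand x) linear_sum /=; apply: eq_bigr => i _.
by rewrite hE.
Qed.

Lemma mx_tensP' : tensor_product_k mx_tens'.
Proof.
have tensE b v : mx_tens' b v = (mx_tens v b)^T by apply/matrixP => i j; rewrite !mxE.
have [[[tl tr] tb] tu] := mx_tensP; split=> [|P f [[fl fr] fb]].
  split=> [|b c v]; last by rewrite !tensE; congr trmx; exact/esym/tb.
  by split=> [v c b b'|b c v w]; rewrite !tensE ?tr ?tl kmx_trP.
have [|g gE gU] := tu P (fun v b => f b v).
  by split=> [|v c b]; last exact/esym/fb.
exists (g \o @kmx_tr k B 1 n)%FUN => [b v|h hE y].
  by rewrite tensE /= /kmx_tr trmxK gE.
rewrite -{1}[y]trmxK.
apply: (gU (h \o @kmx_tr k B n 1)%FUN) => v b.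
by rewrite /= -hE tensE.
Qed.

Definition mx_ract (x : D) (b : B) : D := x *m b%:M.
Definition mx_lact' (b : B) (y : D') : D' := b%:M *m y.
Definition mx_tensB (x : D) (y : D') : T := x *m y.

(** Column times row realizes the tensor product over B inside the square matrices: X is the sum of
    its columns times the unit rows, which determines the induced map. *)
Lemma mx_tensBP : tensor_product mx_ract mx_lact' mx_tensB.
Proof.
split=> [|P f [[fl fr] fb]].
  split=> [|x b y]; last by rewrite /mx_tensB /mx_ract -mulmxA.
  by split=> [y c x x'|x c y y']; [exact: kmxMPl | exact: kmxMPr].
pose d i : D' := delta_mx 0 i.
pose g (X : T) := \sum_i f (col i X) (d i).
have g_linear : linear g.
  move=> c X Y; rewrite /g scaler_sumr -big_split; apply: eq_bigr => i _ /=.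
  rewrite -fl; congr (f _ _); apply/matrixP => l j.
  by rewrite kmxD kmxZ [LHS]mxE kmxD kmxZ !mxE.
pose G := HB.pack g (GRing.isLinear.Build _ _ _ _ g g_linear) : {linear T -> P}.
have f_sum x (r : seq 'I_n) (F : 'I_n -> D') :
    f x (\sum_(i <- r) F i) = \sum_(i <- r) f x (F i).
  pose f' := HB.pack (f x) (GRing.isLinear.Build _ _ _ _ (f x) (fr x))
    : {linear D' -> P}.
  exact: (raddf_sum f').
exists G => [x y|h hE X].
  (* The entries of y are scalars of B in front of unit rows; balancedness moves them onto x. *)
  rewrite [in RHS](_ : y = \sum_i mx_lact' (y 0 i) (d i)).
    rewrite f_sum; apply: eq_bigr => i _; rewrite -fb; congr (f _ _).
    by apply/matrixP => l j; rewrite (ord1 j) !mxE !big_ord1 !mxE eqxx mulr1n.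
  apply/rowP => j; rewrite kmx_sum (bigD1 j) //= big1 => [|l /negPf lj].
    by rewrite !mxE big_ord1 !mxE !eqxx mulr1n mulr1 addr0.
  by rewrite !mxE big_ord1 !mxE eqxx eq_sym lj mulr0.
rewrite {1}(_ : X = \sum_i mx_tensB (col i X) (d i)).
  by rewrite linear_sum; apply: eq_bigr => i _; rewrite hE.
apply/matrixP => i j; rewrite kmx_sum (bigD1 j) //= big1 => [|l /negPf lj].
  by rewrite !mxE big_ord1 !mxE !eqxx mulr1 addr0.
by rewrite !mxE big_ord1 !mxE eqxx eq_sym lj mulr0.
Qed.

Definition mx_lact (a : A) (x : D) : D := rho a *m x.
(** This formula is forced by the definition of a cell ideal: the right action is the left action of
    tau(a) carried over by the switch, which is here the transpose. *)
Definition mx_ract' (y : D') (a : A) : D' := y *m (rho (tau a))^T.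
Definition mx_lactT (a : A) (X : T) : T := rho a *m X.
Definition mx_ractT (X : T) (a : A) : T := X *m (rho (tau a))^T.

Lemma scalar_mxP c (b b' : B) p :
  (c *: b + b')%:M = c *: (b%:M : kmx B p p) + (b'%:M : kmx B p p).
Proof.
by apply/matrixP => i j; rewrite kmxD kmxZ !mxE mulrnDl scalerMnr.
Qed.

(** The case m = 1 is the action on columns, the case m = n the action on the tensor product. *)
Lemma rho_left_action m : left_action (fun a (x : kmx B n m) => rho a *m x).
Proof.
split=> [|x|a b x]; rewrite ?rho1 ?rhoM ?mul1mx ?mulmxA //.
split=> [x c a b|a c x y]; last exact: kmxMPr.
by rewrite rho_linear kmxMPl.
Qed.

Lemma rho_right_action m :
  right_action (fun (y : kmx B m n) a => y *m (rho (tau a))^T).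
Proof.
have [tl tM tK] := tau_invol.
(* [kinvolution] does not list this; it follows from tau(1) = tau(1) tau(tau(1)) = tau(tau(1)). *)
have tau1 : tau 1 = 1 by rewrite -[LHS]mulr1 -[X in _ * X]tK -tM mulr1 tK.
split=> [|y|a b y]; rewrite ?tau1 ?rho1 ?trmx1 ?mulmx1 //.
  split=> [a c x y|y c a b]; first exact: kmxMPl.
  by rewrite tl rho_linear kmx_trP kmxMPr.
by rewrite tM rhoM trmx_mul mulmxA.
Qed.

Lemma scalar_left_action m : left_action (fun b (y : kmx B m n) => b%:M *m y).
Proof.
split=> [|y|b b' y]; rewrite ?mul1mx // ?scalar_mxM ?mulmxA //.
split=> [y c b b'|b c x y]; last exact: kmxMPr.
by rewrite scalar_mxP kmxMPl.
Qed.

Lemma scalar_right_action m : right_action (fun (x : kmx B n m) b => x *m b%:M).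
Proof.
split=> [|x|b b' x]; rewrite ?mulmx1 // ?scalar_mxM ?mulmxA //.
split=> [b c x y|x c b b']; first exact: kmxMPl.
by rewrite scalar_mxP kmxMPr.
Qed.

Lemma id_kinvolution (C : comAlgType k) : kinvolution (id : C -> C).
Proof. by split=> // x y; rewrite mulrC. Qed.

(** The future map alpha. Its value off the range of [beta] is the default 0, which is harmless as
    alpha is constrained on the ideal only. *)
Definition beta_inv (x : A) : T := xget 0 [set X | beta X = x]%classic.

Lemma betaK : cancel beta beta_inv.
Proof.
move=> X; apply: beta_inj; rewrite /beta_inv.
by apply: (@xgetPex _ 0 [set Y | beta Y = beta X]%classic); exists X.
Qed.

(** Conjugating by tau turns right multiplication by a into left multiplication by tau(a), where
    [beta_mull] applies. *)
Lemma beta_mulr X a : beta X * a = beta (X *m (rho (tau a))^T).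
Proof.
have [tl tM tK] := tau_invol.
by rewrite -[LHS]tK tM tau_beta beta_mull tau_beta trmx_mul trmxK.
Qed.

(** Take V = k^n, sigma the identity and alpha the inverse of [beta]. The flip f is then the
    transpose of matrices, and its compatibility with tau is [tau_beta]. *)
Lemma affine_cell_ideal_mx : affine_cell_ideal tau (range beta).
Proof.
have [tl tM tK] := tau_invol; split.
- split=> [|a x [X _ <-]|a x [X _ <-]]; first exact: linear_range_submodule.
  + by exists (rho a *m X) => //; rewrite beta_mull.
  + by exists (X *m (rho (tau a))^T) => //; rewrite beta_mulr.
- apply/seteqP; split=> x /=.
    by case=> y [Y _ <-] <-; exists Y^T; rewrite ?tau_beta.
  by case=> Y _ <-; exists (beta Y^T); [exists Y^T | rewrite tau_beta trmxK].
constructor; refine (@Build_affine_cell_datum k A tau (range beta)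
  V B B_affine id (id_kinvolution B)
  D mx_tens mx_tensP mx_lact mx_ract _ _
  D' mx_tens' mx_tensP' (@kmx_tr k B n 1) _ mx_lact' mx_ract' _ _ _
  T mx_tensB mx_tensBP mx_lactT mx_ractT _ _ _
  beta_inv _ _ _ _ (@kmx_tr k B n n) _ _).
- by split=> [||a x b]; [exact: rho_left_action | exact: scalar_right_action |
    exact/esym/mulmxA].
- move=> v b b'; apply/colP => i; rewrite /mx_ract mul_mx_scalar !mxE.
  by rewrite -scalerAr [b' * b]mulrC.
- by move=> v b; apply/rowP => i; rewrite !mxE.
- by split=> [||b y a]; [exact: scalar_left_action | exact: rho_right_action |
    exact/esym/mulmxA].
- by move=> b b' v; apply/rowP => i; rewrite /mx_lact' mul_scalar_mx !mxE scalerAr.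
- move=> b v a; rewrite /kmx_tr /mx_lact [RHS]trmx_mul; congr (_ *m _).
  by apply/rowP => i; rewrite !mxE.
- by split=> [||a X b]; [exact: rho_left_action | exact: rho_right_action |
    exact/esym/mulmxA].
- by move=> a x y; exact: mulmxA.
- by move=> x y a; exact/esym/mulmxA.
- by move=> c x y [X _ <-] [Y _ <-]; rewrite -beta_linear !betaK.
- by move=> a x [X _ <-]; rewrite beta_mull !betaK.
- by move=> a x [X _ <-]; rewrite beta_mulr !betaK.
- split=> [//|x y /set_mem[X _ <-] /set_mem[Y _ <-]|X _].
    by rewrite !betaK => ->.
  by exists (beta X); [exists X | exact: betaK].
- move=> v1 b1 b2 v2; rewrite /kmx_tr /mx_tensB [LHS]trmx_mul.
  by congr (_ *m _); apply/matrixP => i j; rewrite !mxE.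
- by move=> x [X _ <-]; rewrite tau_beta !betaK.
Qed.

End Criterion.

(** * Laurent polynomials in two variables and the swap *)

(** These three maps of exponents induce the swap of the variables, the specialization x1 = x2 = t,
    and its section sending t to x1. *)
Definition pswap (e : I2) : I2 := (e.2, e.1).
Definition pdeg (e : I2) : int := e.1 + e.2.
Definition pinc (n : int) : I2 := (n, 0).

Lemma pswap_additive : additive pswap. Proof. by []. Qed.
Lemma pdeg_additive : additive pdeg.
Proof. by move=> [a b] [c d]; rewrite /pdeg /= opprD addrACA. Qed.
Lemma pinc_additive : additive pinc.
Proof. by move=> a b; rewrite /pinc; congr pair; rewrite /= subr0. Qed.

HB.instance Definition _ := GRing.isAdditive.Build I2 I2 pswap pswap_additive.
HB.instance Definition _ := GRing.isAdditive.Build I2 int pdeg pdeg_additive.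
HB.instance Definition _ := GRing.isAdditive.Build int I2 pinc pinc_additive.

Lemma pswapK : involutive pswap. Proof. by case. Qed.

Local Notation R := (galg rat I2).
Local Notation L := (galg rat int).
Local Notation lswap := (gmap rat pswap).
Local Notation ldiag := (gmap rat pdeg).
Local Notation linc := (gmap rat pinc).

HB.lock Definition lx1 : R := gmon rat ((1, 0) : I2).
HB.lock Definition lx2 : R := gmon rat ((0, 1) : I2).

Lemma lswapK : involutive lswap.
Proof.
apply: (@linear_ext _ _ _ (lswap \o lswap)%FUN idfun) => e.
by rewrite /= !gmapU; case: e.
Qed.

Lemma lswap_x1 : lswap lx1 = lx2. Proof. by rewrite lx1.unlock lx2.unlock gmapU. Qed.
Lemma lswap_x2 : lswap lx2 = lx1. Proof. by rewrite lx1.unlock lx2.unlock gmapU. Qed.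

Lemma ldiag_swap f : ldiag (lswap f) = ldiag f.
Proof.
move: f; apply: (@linear_ext _ _ _ (ldiag \o lswap)%FUN ldiag) => e.
by rewrite /= !gmapU; congr gmon; exact: addrC.
Qed.

Lemma lincK : cancel linc ldiag.
Proof.
apply: (@linear_ext _ _ _ (ldiag \o linc)%FUN idfun) => n.
by rewrite /= !gmapU; congr gmon; exact: addr0.
Qed.

Lemma lswap_coef f e : (lswap f)@_e = f@_(pswap e).
Proof.
elim/galg_ind: f => [|c f g IHf IHg|x]; first by rewrite linear0 !mcoeff0.
  by rewrite linearP !mcoeffD !mcoeffZ IHf IHg.
by rewrite gmapU !gmon_coef (can2_eq pswapK pswapK).
Qed.

(** * Divisibility by x1 - x2 *)

Definition delta_dvd (f : R) : Prop := exists g, f = (lx1 - lx2) * g.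

Lemma delta_reg f : (lx1 - lx2) * f = 0 -> f = 0.
Proof.
move=> df0.
(* The coefficients of [f] are constant along the antidiagonals. *)
have step a b n : f@_(a, b) = f@_(a + n%:Z, b - n%:Z).
  elim: n => [|n ->]; first by rewrite addr0 subr0.
  have := congr1 (fun g : R => g@_(a + n.+1%:Z, b - n%:Z)) df0.
  rewrite mulrBl mcoeffB lx1.unlock lx2.unlock !gmonM_coef mcoeff0 => /eqP.
  rewrite subr_eq0 => /eqP E.
  rewrite (_ : (a + n%:Z, b - n%:Z) = (a + n.+1%:Z, b - n%:Z) - (1, 0) :> I2).
    by rewrite E; congr (f@_ _); congr pair => /=; lia.
  by congr pair => /=; lia.
apply: galg_ext => -[a b]; rewrite mcoeff0.
(* [m] bounds the first coordinates of the support, so m + |a| + 1 steps along the antidiagonal lead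
   out of it. *)
pose m := (\sum_(e <- msupp f) `|e.1|)%N.
have bnd c d : (c, d) \in msupp f -> (`|c| <= m)%N.
  by move=> cd_f; rewrite /m (big_fsetD1 _ cd_f) leq_addr.
rewrite (step a b (m + `|a|).+1); apply: mcoeff_outdom; apply/negP => /bnd.
lia.
Qed.

Lemma lattice_ind (P : I2 -> Prop) : P (1, 0) -> P (0, 1) ->
  (forall e, P e -> P (- e)) -> (forall d e, P d -> P e -> P (d + e)) ->
  forall e, P e.
Proof.
move=> P1 P2 PN PD.
have PZ e (n : int) : P e -> P (e *~ n).
  move=> Pe; have Pn m : P (e *+ m).
    elim: m => [|m IHm]; last by rewrite mulrS; exact: PD.
    by rewrite mulr0n -[0](addrN e); apply: PD => //; exact: PN.
  by case: n => m; [exact: Pn | rewrite NegzE mulrNz; apply: PN; exact: Pn].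
move=> [a b].
have -> : (a, b) = (1, 0) *~ a + (0, 1) *~ b :> I2.
  have E (u : I2) (n : int) : u *~ n = (u.1 *~ n, u.2 *~ n).
    have En m : u *+ m = (u.1 *+ m, u.2 *+ m).
      by elim: m => // m IHm; rewrite !mulrS IHm.
    by case: n => m; rewrite ?NegzE ?mulrNz -?pmulrn !En.
  rewrite !E /= !mul0rz !intz; congr pair; rewrite /= ?addr0 ?add0r //.
by apply: PD; exact: PZ.
Qed.

Lemma delta_dvd0 : delta_dvd 0. Proof. by exists 0; rewrite mulr0. Qed.

Lemma delta_dvdZD c f g : delta_dvd f -> delta_dvd g -> delta_dvd (c *: f + g).
Proof. by move=> [u ->] [v ->]; exists (c *: u + v); rewrite mulrDr scalerAr. Qed.

Lemma delta_dvdM f g : delta_dvd f -> delta_dvd (g * f).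
Proof. by move=> [u ->]; exists (g * u); rewrite mulrCA. Qed.

Lemma delta_dvdD f g : delta_dvd f -> delta_dvd g -> delta_dvd (f + g).
Proof. by move=> df; rewrite -[f]scale1r; exact: delta_dvdZD. Qed.

(** Being congruent to the identity modulo x1 - x2 can be checked on the variables, since it passes
    to products, inverses and linear combinations. *)
Lemma delta_dvd_endo (h : {lrmorphism R -> R}) :
  delta_dvd (lx1 - h lx1) -> delta_dvd (lx2 - h lx2) ->
  forall f, delta_dvd (f - h f).
Proof.
move=> d1 d2; elim/galg_ind => [|c f g IHf IHg|e].
- by rewrite raddf0 subr0; exact: delta_dvd0.
- by rewrite linearP opprD addrACA -scalerBr; exact: delta_dvdZD.
apply: (@lattice_ind (fun e => delta_dvd (gmon rat e - h (gmon rat e)))) e;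
  [by rewrite -lx1.unlock | by rewrite -lx2.unlock | move=> e | move=> d e].
  have hV : h (gmon rat e) * h (gmon rat (- e)) = 1.
    by rewrite -rmorphM -gmonD addrN rmorph1.
  have gV : gmon rat e * gmon rat (- e) = 1 by rewrite -gmonD addrN.
  (* For v inverse to u, v - h(v) = - v h(v) (u - h(u)). *)
  move=> /(delta_dvdM (- (gmon rat (- e) * h (gmon rat (- e))))).
  congr delta_dvd; move: (gmon rat e) (gmon rat (- e)) hV gV => u v hV gV.
  transitivity (v * (h u * h v) - (u * v) * h v); first by ring.
  by rewrite hV gV mulr1 mul1r.
rewrite gmonD rmorphM; move: (gmon rat d) (gmon rat e) => u v du dv.
have -> : u * v - h u * h v = v * (u - h u) + h u * (v - h v) by ring.
by apply: delta_dvdD; exact: delta_dvdM.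
Qed.

Lemma delta_dvd_swap f : delta_dvd (f - lswap f).
Proof.
apply: (@delta_dvd_endo lswap); rewrite /= ?lswap_x1 ?lswap_x2.
  by exists 1; rewrite mulr1.
by exists (-1); ring.
Qed.

Lemma ldiag_x1 : ldiag lx1 = gmon rat 1.
Proof. by rewrite lx1.unlock gmapU. Qed.

Lemma ldiag_x2 : ldiag lx2 = gmon rat 1.
Proof. by rewrite lx2.unlock gmapU. Qed.

Lemma linc_x : linc (gmon rat 1) = lx1.
Proof. by rewrite lx1.unlock gmapU. Qed.

(** The endomorphism [linc] after [ldiag] sends both variables to x1, hence is congruent to the
    identity modulo x1 - x2; if it kills f, then f is divisible. *)
Lemma delta_dvd_ker f : ldiag f = 0 <-> delta_dvd f.
Proof.
split=> [f0|[g ->]]; last by rewrite rmorphM rmorphB /= ldiag_x1 ldiag_x2 subrr mul0r.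
have := @delta_dvd_endo (linc \o ldiag)%FUN _ _ f.
rewrite /= f0 raddf0 subr0 ldiag_x1 ldiag_x2 linc_x subrr; apply.
  exact: delta_dvd0.
by exists (-1); ring.
Qed.

(** * The algebra B of symmetric Laurent polynomials *)

Definition lsym : {pred R} := [pred f | lswap f == f].

Lemma lsym_subalg_closed : subalg_closed lsym.
Proof.
split=> [|c f g|f g]; rewrite !inE ?rmorph1 // => /eqP fE /eqP gE.
  by rewrite linearP /= fE gE.
by rewrite rmorphM /= fE gE.
Qed.

HB.instance Definition _ := GRing.isSubalgClosed.Build rat R lsym lsym_subalg_closed.

Record symlaurent := SymLaurent { symval :> R; symvalP : symval \in lsym }.

HB.instance Definition _ := [isSub for symval].
HB.instance Definition _ := [Choice of symlaurent by <:].
HB.instance Definition _ := [SubChoice_isSubAlgebra of symlaurent by <:].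
HB.instance Definition _ := [SubNzRing_isSubComNzRing of symlaurent by <:].

Lemma lswapN_delta : lswap (lx1 - lx2) = - (lx1 - lx2).
Proof. by rewrite rmorphB /= lswap_x1 lswap_x2 opprB. Qed.

(** Take for the second component the divided difference g = (f - s(f)) / (x1 - x2). It is symmetric
    because numerator and denominator both change sign and x1 - x2 is regular; then f - x1 g is
    symmetric too. *)
Lemma lsplit f : exists b : symlaurent * symlaurent,
  f = symval b.1 + lx1 * symval b.2.
Proof.
have [g fg] := delta_dvd_swap f.
have g_sym : lswap g = g.
  apply/eqP; rewrite -subr_eq0; apply/eqP/delta_reg.
  have := congr1 lswap fg; rewrite rmorphB rmorphM /= lswapK lswapN_delta.
  by move=> E; rewrite mulrBr -fg -[_ * lswap g]opprK -mulNr -E; ring.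
have gP : g \in lsym by rewrite inE g_sym.
have hP : f - lx1 * g \in lsym.
  rewrite inE rmorphB rmorphM /= lswap_x1 g_sym -subr_eq0; apply/eqP.
  transitivity ((lx1 - lx2) * g - (f - lswap f)); last by rewrite fg subrr.
  by move: (lswap f) => sf; ring.
by exists (SymLaurent hP, SymLaurent gP); rewrite /= subrK.
Qed.

Lemma I2_mulrn (u : I2) n : u *+ n = (u.1 *+ n, u.2 *+ n).
Proof. by elim: n => // n IHn; rewrite !mulrS IHn. Qed.

(** B is generated by e1 = x1 + x2, e2 = x1 x2 and 1/e2: orbit sums of monomials are powers of e2
    times power sums, and these are polynomials in e1 and e2. *)
Lemma lsym_ind (P : R -> Prop) :
  P 1 -> P (lx1 + lx2) -> P (lx1 * lx2) -> P (gmon rat (-1, -1)) ->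
  (forall c f g, P f -> P g -> P (c *: f + g)) ->
  (forall f g, P f -> P g -> P (f * g)) ->
  forall f, f \in lsym -> P f.
Proof.
move=> P1 Pe1 Pe2 Pe2' PZD PM.
have PD f g : P f -> P g -> P (f + g) by rewrite -{2}[f]scale1r; exact: PZD.
have P0 : P 0 by have := PZD (-1) 1 1 P1 P1; rewrite scaleN1r addNr.
have PX f n : P f -> P (f ^+ n).
  by move=> Pf; elim: n => // n IHn; rewrite exprS; exact: PM.
(* Two consecutive power sums are carried along for the recursion p_(n+2) = e1 p_(n+1) - e2 p_n. *)
have Ppow n : P (lx1 ^+ n + lx2 ^+ n) /\ P (lx1 ^+ n.+1 + lx2 ^+ n.+1).
  elim: n => [|n [IH1 IH2]]; first by split; [exact: PD | exact: Pe1].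
  split=> //; have -> : lx1 ^+ n.+2 + lx2 ^+ n.+2 =
    (-1) *: (lx1 * lx2 * (lx1 ^+ n + lx2 ^+ n))
    + (lx1 + lx2) * (lx1 ^+ n.+1 + lx2 ^+ n.+1).
    by rewrite scaleN1r !exprS; ring.
  by apply: PZD; [exact: PM Pe2 IH1 | exact: PM Pe1 IH2].
have e2E : lx1 * lx2 = gmon rat ((1, 1) : I2).
  by rewrite lx1.unlock lx2.unlock -gmonD.
have Pdiag (b : int) : P (gmon rat ((b, b) : I2)).
  case: b => n.
    have -> : (Posz n, Posz n) = ((1, 1) : I2) *+ n by rewrite I2_mulrn /= natz.
    by rewrite gmonMn -e2E; exact: PX.
  have -> : (Negz n, Negz n) = ((-1, -1) : I2) *+ n.+1.
    by rewrite I2_mulrn /= mulNrn natz NegzE.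
  by rewrite gmonMn; exact: PX.
have Ple (a b : int) : (b <= a)%R ->
    P (gmon rat ((a, b) : I2) + gmon rat ((b, a) : I2)).
  move=> ba; have [n ->] : exists n, a = b + Posz n by exists `|a - b|%N; lia.
  have -> : (b + Posz n, b) = (b, b) + (1, 0) *+ n :> I2.
    by rewrite I2_mulrn /= natz mul0rn; congr pair; rewrite /= ?addr0.
  have -> : (b, b + Posz n) = (b, b) + (0, 1) *+ n :> I2.
    by rewrite I2_mulrn /= natz mul0rn; congr pair; rewrite /= ?addr0.
  rewrite !gmonD !gmonMn -lx1.unlock -lx2.unlock -mulrDr.
  by apply: PM; [exact: Pdiag | have [] := Ppow n].
have Psum f : P (f + lswap f).
  elim/galg_ind: f => [|c f g IHf IHg|[a b]].
  - by rewrite raddf0 addr0.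
  - suff -> : (c *: f + g) + lswap (c *: f + g) =
      c *: (f + lswap f) + (g + lswap g)
      by exact: (PZD _ _ _ IHf IHg).
    by rewrite linearP /= scalerDr addrACA.
  rewrite gmapU; have /orP[/Ple//|/Ple] := le_total b a.
  by rewrite addrC.
move=> f /eqP fE.
(* A symmetric f is its own average over the swap, as 2 is invertible in the rationals. *)
have -> : f = (1 / 2%:R) *: (f + lswap f) + 0.
  by rewrite fE addr0 -mulr2n -scalerMnr scalerMnl -mulr_natr mulrVK ?scale1r.
exact: (PZD _ _ _ (Psum f) P0).
Qed.

Lemma symlaurent_affine : affine_algebra (symlaurent : comAlgType rat).
Proof.
have e1P : lx1 + lx2 \in lsym by rewrite inE rmorphD /= lswap_x1 lswap_x2 addrC.
have e2P : lx1 * lx2 \in lsym by rewrite inE rmorphM /= lswap_x1 lswap_x2 mulrC.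
have e3P : gmon rat (-1, -1) \in lsym by rewrite inE gmapU.
apply: (@affine_algebra_generated _ _ 3
  (tnth [tuple SymLaurent e1P; SymLaurent e2P; SymLaurent e3P])) => P P1 Pe PZD PM b.
suff [c cE Pc] : exists2 c : symlaurent, symval c = symval b & P c.
  by rewrite -(val_inj cE).
apply: (@lsym_ind (fun f => exists2 c : symlaurent, symval c = f & P c));
  last exact: (symvalP b).
- by exists 1.
- by exists (SymLaurent e1P) => //; have := Pe 0.
- by exists (SymLaurent e2P) => //; have := Pe 1.
- by exists (SymLaurent e3P) => //; have := Pe (inord 2); rewrite (tnth_nth 0) /= inordK.
- by move=> c f g [u <- Pu] [v <- Pv]; exists (c *: u + v) => //; exact: PZD.
- by move=> f g [u <- Pu] [v <- Pv]; exists (u * v) => //; exact: PM.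
Qed.

Lemma laurent_affine : affine_algebra (L : comAlgType rat).
Proof.
apply: (@affine_algebra_generated _ _ 2
  (tnth [tuple gmon rat (1 : int); gmon rat (-1 : int)])) => P P1 Pe PZD PM.
have PX f n : P f -> P (f ^+ n).
  by move=> Pf; elim: n => // n IHn; rewrite exprS; exact: PM.
elim/galg_ind => [|c f g|n]; last 2 first.
- exact: PZD.
- case: n => n; first by rewrite -[Posz n]natz gmonMn; apply: PX; exact: (Pe 0).
  by rewrite NegzE -natz -mulNrn gmonMn; apply: PX; exact: (Pe 1).
by have := PZD (-1) 1 1 P1 P1; rewrite scaleN1r addNr.
Qed.

(** * S(2,2) as an algebra of swap-invariant matrices *)

Definition i0 : 'I_4 := @Ordinal 4 0 isT.
Definition i1 : 'I_4 := @Ordinal 4 1 isT.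
Definition i2 : 'I_4 := @Ordinal 4 2 isT.
Definition i3 : 'I_4 := @Ordinal 4 3 isT.

Lemma I4_ind (P : 'I_4 -> Prop) : P i0 -> P i1 -> P i2 -> P i3 -> forall i, P i.
Proof.
move=> P0 P1 P2 P3 [[|[|[|[|//]]]] lti].
- by rewrite (_ : Ordinal lti = i0) //; exact: val_inj.
- by rewrite (_ : Ordinal lti = i1) //; exact: val_inj.
- by rewrite (_ : Ordinal lti = i2) //; exact: val_inj.
- by rewrite (_ : Ordinal lti = i3) //; exact: val_inj.
Qed.

Lemma sum_I4 (V : nmodType) (F : 'I_4 -> V) :
  \sum_i F i = F i0 + F i1 + F i2 + F i3.
Proof.
rewrite !big_ord_recl big_ord0 addr0 !addrA.
by congr (_ + _ + _ + _); congr F; exact: val_inj.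
Qed.

(* The residues modulo 2 of a point of Z^2 are numbered so that [i2] and [i3] are
   (0,1) and (1,0); [isw] is the effect of the place permutation on them. *)
Definition isw (i : 'I_4) : 'I_4 := if i == i2 then i3 else if i == i3 then i2 else i.

Definition res (i : 'I_4) : I2 :=
  (Posz ((i == i1) || (i == i3)), Posz ((i == i1) || (i == i2))).

Definition idx (p : I2) : 'I_4 :=
  if (p.1 %% 2)%Z == 0 then if (p.2 %% 2)%Z == 0 then i0 else i2
  else if (p.2 %% 2)%Z == 0 then i3 else i1.

Definition quo (p : I2) : I2 := ((p.1 %/ 2)%Z, (p.2 %/ 2)%Z).

Lemma iswK : involutive isw.
Proof. by elim/I4_ind. Qed.

Lemma res_isw i : res (isw i) = pswap (res i).
Proof. by elim/I4_ind: i. Qed.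

Lemma idx_quoE p : p = res (idx p) + quo p *+ 2.
Proof.
case: p => a b; rewrite I2_mulrn /idx /quo /=.
by do 2 case: eqP => ? ; congr pair; rewrite /= mulr2n; lia.
Qed.

Lemma idx_res i e : idx (res i + e *+ 2) = i.
Proof.
case: e => a b; rewrite I2_mulrn /idx /res /= !mulr2n.
by elim/I4_ind: i => /=; do 2 case: eqP => ?  //; lia.
Qed.

Lemma quo_res i e : quo (res i + e *+ 2) = e.
Proof.
case: e => a b; rewrite I2_mulrn /quo /res /= !mulr2n.
by elim/I4_ind: i => /=; congr pair; lia.
Qed.

Lemma idx_pswap p : idx (pswap p) = isw (idx p).
Proof. by rewrite /idx /=; do 2 case: eqP. Qed.

Lemma quo_pswap p : quo (pswap p) = pswap (quo p).
Proof. by []. Qed.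

Lemma idxD p e : idx (p + e *+ 2) = idx p.
Proof. by rewrite {1}[p]idx_quoE -addrA -mulrnDl idx_res. Qed.

Lemma quoD p e : quo (p + e *+ 2) = quo p + e.
Proof. by rewrite {1}[p]idx_quoE -addrA -mulrnDl quo_res. Qed.

Lemma orbD p q e : orb (p + e *+ 2) (q + e *+ 2) = orb p q.
Proof. exact: (orb_act false e). Qed.

Lemma orb_pswap p q : orb (pswap p) (pswap q) = orb p q.
Proof.
by have := orb_act true 0 p q; rewrite /aff_act mul0rn !addr0.
Qed.

(** An element is a kernel on pairs of points, and the values at (p, q + 2e) are collected as
    coefficients of x^e. When q is a residue, e is the quotient of q + 2e, so the finite set of
    exponents catches all nonzero values. *)
Definition lkernel (f : S22) (p q : I2) : R :=
  [malg e in [fset quo s | s in S22_nbr f p]%fset => f@_(orb p (q + e *+ 2))].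

HB.lock Definition S22_mx (f : S22) : 'M[R]_4 :=
  \matrix_(i, j) lkernel f (res i) (res j).

Lemma S22_mxE f i j e : (S22_mx f i j)@_e = f@_(orb (res i) (res j + e *+ 2)).
Proof.
rewrite unlock mxE /lkernel mcoeffE; case: ifPn => // /negP e_nbr; apply/esym/S22_nbrP.
apply/negP => s_nbr; apply: e_nbr; apply/imfsetP.
by exists (res j + e *+ 2); rewrite ?quo_res.
Qed.

(** Translation by -2 [quo p] moves p to its residue within the orbit, so the matrix entries record
    every coefficient. *)
Lemma S22_mx_coef f p q :
  f@_(orb p q) = (S22_mx f (idx p) (idx q))@_(quo q - quo p).
Proof.
rewrite S22_mxE -[in RHS](orbD _ _ (quo p)) -idx_quoE; congr (_@_(orb _ _)).
by rewrite -addrA -mulrnDl subrK -idx_quoE.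
Qed.

Lemma S22_mx_inj : injective S22_mx.
Proof. by move=> f g fg; apply: S22_ext => p q; rewrite !S22_mx_coef fg. Qed.

Lemma S22_mxP c f g i j : S22_mx (c *: f + g) i j = c *: S22_mx f i j + S22_mx g i j.
Proof.
by apply: galg_ext => e; rewrite mcoeffD mcoeffZ !S22_mxE mcoeffD mcoeffZ.
Qed.

Lemma S22_mx1 : S22_mx 1 = 1%:M.
Proof.
apply/matrixP => i j; apply: galg_ext => e; rewrite S22_mxE S22_oneE !mxE.
have -> : (res i == res j + e *+ 2) = (i == j) && (e == 0).
  apply/eqP/andP => [E|[/eqP-> /eqP->]]; last by rewrite mul0rn addr0.
  have := idx_res j e; have := quo_res j e; rewrite -E.
  by rewrite -[res i]addr0 -[X in _ + X](mul0rn _ 2) idx_res quo_res => -> ->.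
by case: eqP => _ /=; rewrite ?mcoeff0 // gmon_coef eq_sym.
Qed.

(** The product sums over intermediate points s. Writing s = [res m] + 2d, the sum over m is matrix
    multiplication and the sum over d is multiplication of Laurent polynomials. *)
Lemma S22_mxM f g : S22_mx (f * g) = S22_mx f *m S22_mx g.
Proof.
apply/matrixP => i j; apply: galg_ext => e; rewrite S22_mxE mxE raddf_sum /=.
pose D := [fset quo s | s in S22_nbr f (res i)]%fset.
pose l := [seq res m + d *+ 2 | m <- enum 'I_4, d <- D].
have fD m d : d \notin D -> f@_(orb (res i) (res m + d *+ 2)) = 0.
  move=> dD; apply/S22_nbrP; apply/negP => s_nbr; move/negP: dD; apply.
  apply/imfsetP.
  by exists (res m + d *+ 2); rewrite ?quo_res.
have l_uniq : uniq l.
  apply: allpairs_uniq; rewrite ?enum_uniq ?fset_uniq // => -[m d] [m' d'] _ _ /= E.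
  by rewrite -(idx_res m d) -{2}(quo_res m d) E idx_res quo_res.
rewrite (@S22_mulE _ _ _ _ [fset s in l]%fset); last first.
  move=> s; rewrite !inE [s]idx_quoE => sl; apply: fD; apply: contra sl => sD.
  by apply: (allpairs_f (fun m d => res m + d *+ 2)); rewrite ?mem_enum.
rewrite (perm_big l); last first.
  by apply: uniq_perm => [||s] //; [exact: fset_uniq | rewrite !inE].
rewrite /l big_allpairs_dep -[RHS]big_enum; apply: eq_bigr => m _ /=.
rewrite (@gmulE _ _ _ _ D); last by move=> d /fD; rewrite S22_mxE.
apply: eq_bigr => d _; rewrite !S22_mxE; congr (_ * _).
by rewrite -[in RHS](orbD _ _ d) -addrA -mulrnDl subrK.
Qed.

Definition swap_inv (M : 'M[R]_4) : Prop :=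
  forall i j, M (isw i) (isw j) = lswap (M i j).

Lemma S22_mx_inv f : swap_inv (S22_mx f).
Proof.
move=> i j; apply: galg_ext => e; rewrite lswap_coef !S22_mxE !res_isw.
rewrite -[LHS]/(f@_(orb _ _)) -[in LHS](orb_pswap).
by rewrite raddfD raddfMn /= !pswapK.
Qed.

(** The kernel [K] read off from M is constant on orbits: translations cancel in the difference of
    quotients, and the place permutation is absorbed by [swap_inv]. *)
Lemma S22_mx_surj M : swap_inv M -> exists f, S22_mx f = M.
Proof.
move=> Minv; pose K p q := (M (idx p) (idx q))@_(quo q - quo p).
have K_orb p q p' q' : orb p q = orb p' q' -> K p q = K p' q'.
  move=> /eqP; rewrite orbE => /asboolP[w [e [/= -> ->]]]; rewrite /K /aff_act.
  have addK (a b c : I2) : a + c - (b + c) = a - b by rewrite opprD addrACA addrN addr0.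
  rewrite !idxD !quoD addK; case: w => //.
  rewrite -!/(pswap _) !idx_pswap !quo_pswap Minv lswap_coef.
  by rewrite raddfB /= !pswapK.
pose l := flatten
  [seq [seq orb (res x.1) (res x.2 + e *+ 2) | e <- msupp (M x.1 x.2)]
     | x <- enum {: 'I_4 * 'I_4}].
pose D := [fset z in l]%fset.
exists [malg z in D => K (orb_repr z).1 (orb_repr z).2].
have KD p q : orb p q \notin D -> K p q = 0.
  move=> pqD; apply: mcoeff_outdom; apply: contra pqD => pqM.
  rewrite !inE; apply/flattenP.
  exists [seq orb (res (idx p)) (res (idx q) + e *+ 2) | e <- msupp (M (idx p) (idx q))].
    by apply/mapP; exists (idx p, idx q); rewrite ?mem_enum.
  apply/mapP; exists (quo q - quo p) => //.
  by rewrite -[RHS](orbD _ _ (quo p)) -addrA -mulrnDl subrK -!idx_quoE.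
apply/matrixP => i j; apply: galg_ext => e; rewrite S22_mxE.
have -> : (M i j)@_e = K (res i) (res j + e *+ 2).
  have ri : res i = res i + 0 *+ 2 by rewrite mul0rn addr0.
  by rewrite /K ri !idx_res !quo_res subr0.
move: (res i) (res j + e *+ 2) => p q; rewrite [LHS]mcoeffE.
by case: ifPn => [_|/KD//]; apply: K_orb; rewrite orb_reprK.
Qed.

(** * The cell chain *)

Lemma symval_is_linear : linear symval. Proof. by []. Qed.
Lemma symval_is_monoid_morphism : monoid_morphism symval. Proof. by []. Qed.

HB.instance Definition _ := GRing.isLinear.Build rat symlaurent R *:%R symval
  symval_is_linear.
HB.instance Definition _ := GRing.isMonoidMorphism.Build symlaurent R symval
  symval_is_monoid_morphism.

Lemma lswap_symval (b : symlaurent) : lswap b = b.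
Proof. exact/eqP/(symvalP b). Qed.

Lemma symval_inj : injective symval. Proof. exact: val_inj. Qed.

Local Notation symmx := (map_mx symval).

(** The inverse of [S22_mx] on swap-invariant matrices, and 0 elsewhere. *)
HB.lock Definition S22_of (M : 'M[R]_4) : S22 :=
  xget 0 [set f | S22_mx f = M]%classic.

Lemma S22_ofK M : swap_inv M -> S22_mx (S22_of M) = M.
Proof.
move=> /S22_mx_surj Mf; rewrite S22_of.unlock.
exact: (@xgetPex _ 0 [set f | S22_mx f = M]%classic).
Qed.

Lemma swap_inv_tr M : swap_inv M -> swap_inv M^T.
Proof. by move=> Minv i j; rewrite !mxE. Qed.

(** The involution exchanging [xi i j] and [xi j i] would also invert x1 and x2; the plain transpose
    does not, which allows sigma to be the identity. *)
Definition S22_tr (f : S22) : S22 := S22_of (S22_mx f)^T.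

Lemma S22_trE f : S22_mx (S22_tr f) = (S22_mx f)^T.
Proof. by apply/S22_ofK/swap_inv_tr; exact: S22_mx_inv. Qed.

Lemma S22_tr_kinvolution : @kinvolution rat S22 S22_tr.
Proof.
split=> [c f g|f g|f]; apply: S22_mx_inj.
- by apply/matrixP => i j; rewrite S22_trE mxE !S22_mxP !S22_trE !mxE.
- by rewrite S22_trE !S22_mxM !S22_trE trmx_mul.
- by rewrite !S22_trE trmxK.
Qed.

(** * Columns fixed by the twisted swap *)

Definition swap_col n (C : 'M[R]_(4, n)) : Prop :=
  forall i j, C (isw i) j = lswap (C i j).

Lemma swap_invM n (M : 'M[R]_4) (C : 'M[R]_(4, n)) :
  swap_inv M -> swap_col C -> swap_col (M *m C).
Proof.
move=> Minv Cinv i j; rewrite !mxE raddf_sum /= (reindex_inj (inv_inj iswK)) /=.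
by apply: eq_bigr => m _; rewrite Minv Cinv rmorphM.
Qed.

Lemma swap_colM n m (C : 'M[R]_(4, n)) (X : 'M[symlaurent]_(n, m)) :
  swap_col C -> swap_col (C *m symmx X).
Proof.
move=> Cinv i j; rewrite !mxE raddf_sum /=; apply: eq_bigr => l _.
by rewrite Cinv rmorphM /= !mxE lswap_symval.
Qed.

Lemma swap_col_tr n (C D : 'M[R]_(4, n)) :
  swap_col C -> swap_col D -> swap_inv (C *m D^T).
Proof.
move=> Cinv Dinv i j; rewrite !mxE raddf_sum /=; apply: eq_bigr => l _.
by rewrite !mxE Cinv Dinv rmorphM.
Qed.

(* The columns of [cell_basis] form a basis, over the symmetric Laurent
   polynomials, of the vectors fixed by the twisted swap. *)
Definition cell_basis : 'M[R]_4 := \matrix_(i, j)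
  if j == i3 then if i == i2 then lx1 else if i == i3 then lx2 else 0
  else ((i == j) || (i == i3) && (j == i2))%:R.

Local Notation P := cell_basis.

Lemma swap_col_basis : swap_col P.
Proof.
move=> i j; rewrite !mxE.
elim/I4_ind: i; elim/I4_ind: j => /=;
  by rewrite ?raddf0 ?rmorph1 ?lswap_x1 ?lswap_x2.
Qed.

Lemma cell_basisM n (X : 'M[R]_(4, n)) j :
  [/\ (P *m X) i0 j = X i0 j, (P *m X) i1 j = X i1 j,
      (P *m X) i2 j = X i2 j + lx1 * X i3 j
    & (P *m X) i3 j = X i2 j + lx2 * X i3 j].
Proof.
by split; rewrite mxE sum_I4 !mxE /= ?mul1r ?mul0r ?addr0 ?add0r.
Qed.

(** The only nontrivial block of P has rows (1, x1) and (1, x2), and its determinant x2 - x1 is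
    regular. *)
Lemma cell_basis_inj n : injective (mulmx P : 'M[R]_(4, n) -> _).
Proof.
move=> X Y XY; apply/eqP; rewrite -subr_eq0; apply/eqP; set Z := X - Y.
have PZ0 : P *m Z = 0 by rewrite mulmxBr XY subrr.
apply/matrixP => i j; have PZ k : (P *m Z) k j = 0 by rewrite PZ0 mxE.
have := cell_basisM Z j; rewrite !PZ => -[Z0 Z1 Z2 Z3]; rewrite [RHS]mxE.
have Z3j : Z i3 j = 0.
  apply: delta_reg; transitivity ((Z i2 j + lx1 * Z i3 j) - (Z i2 j + lx2 * Z i3 j)).
    by move: (Z i2 j) (Z i3 j) => u v; ring.
  by rewrite -Z2 -Z3 subrr.
have Z2j : Z i2 j = 0 by move: Z2; rewrite Z3j mulr0 addr0 => <-.
by elim/I4_ind: i; rewrite ?Z2j ?Z3j -?Z0 -?Z1.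
Qed.

Lemma cell_basis_trinj n : injective (mulmxr P^T : 'M[R]_(n, 4) -> _).
Proof.
move=> X Y /= /(congr1 trmx); rewrite !trmx_mul !trmxK => /cell_basis_inj.
exact: trmx_inj.
Qed.

(** A fixed column has symmetric entries at [i0] and [i1], and its entry at [i3] is the swap of the
    one at [i2], which [lsplit] decomposes over B. *)
Lemma cell_basis_solve n (C : 'M[R]_(4, n)) : swap_col C ->
  exists X : 'M[symlaurent]_(4, n), C = P *m symmx X.
Proof.
move=> Cinv; pose b j := sval (cid (lsplit (C i2 j))).
have bE j : C i2 j = symval (b j).1 + lx1 * symval (b j).2.
  by rewrite /b; case: cid.
pose X : 'M[symlaurent]_(4, n) := \matrix_(i, j)
  if i == i2 then (b j).1 else if i == i3 then (b j).2 else insubd 0 (C i j).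
exists X; apply/matrixP => i j; have [X0 X1 X2 X3] := cell_basisM (symmx X) j.
have Cfix k : isw k = k -> symval (insubd 0 (C k j)) = C k j.
  move=> kE; apply: (@insubdK _ _ symlaurent); rewrite !inE.
  by rewrite -{1}Cinv kE.
elim/I4_ind: i; rewrite ?(X0, X1, X2, X3) !mxE /= ?Cfix //.
by rewrite (Cinv i2 j) bE rmorphD rmorphM /= !lswap_symval lswap_x1.
Qed.

(** The matrix over B, in the basis P, of f acting on the fixed columns. *)
Definition cell_rho (f : S22) : kmx (symlaurent : comAlgType rat) 4 4 :=
  xget 0 [set X | S22_mx f *m P = P *m symmx X]%classic.

Lemma cell_rhoE f : S22_mx f *m P = P *m symmx (cell_rho f).
Proof.
apply: (@xgetPex _ 0 [set X | S22_mx f *m P = P *m symmx X]%classic).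
by apply/cell_basis_solve/swap_invM; [exact: S22_mx_inv | exact: swap_col_basis].
Qed.

Lemma symmx_inj m n : injective (map_mx symval : 'M_(m, n) -> 'M_(m, n)).
Proof.
move=> X Y /matrixP XY; apply/matrixP => i j.
by have := XY i j; rewrite !mxE => /symval_inj.
Qed.

Lemma cell_rho_eq f X : S22_mx f *m P = P *m symmx X -> cell_rho f = X.
Proof. by rewrite cell_rhoE => /cell_basis_inj/symmx_inj. Qed.

Definition cell_beta (X : kmx (symlaurent : comAlgType rat) 4 4) : S22 :=
  S22_of (P *m symmx X *m P^T).

Lemma cell_betaE X : S22_mx (cell_beta X) = P *m symmx X *m P^T.
Proof.
apply/S22_ofK/swap_col_tr; last exact: swap_col_basis.
exact/swap_colM/swap_col_basis.
Qed.

(** * The morphism onto Q[t, 1/t] and its kernel *)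

Definition S22_pi (f : S22) : L := ldiag (S22_mx f i2 i2 - S22_mx f i2 i3).

Lemma S22_pi_is_linear : linear S22_pi.
Proof.
move=> c f g; rewrite /S22_pi !S22_mxP opprD addrACA -scalerBr.
exact: gmap_is_linear.
Qed.

(** Modulo x1 - x2 the swap is trivial, so e_2 - e_3 is an eigenvector of every invariant matrix M,
    with eigenvalue M_22 - M_23; eigenvalues on a common eigenvector multiply. *)
Lemma S22_pi_is_monoid_morphism : monoid_morphism S22_pi.
Proof.
split=> [|f g]; first by rewrite /S22_pi S22_mx1 !mxE /= subr0 rmorph1.
rewrite /S22_pi S22_mxM -rmorphM.
have inv h := S22_mx_inv h; move: (S22_mx f) (S22_mx g) (inv f) (inv g) => M N _ Ninv.
have N03 : N i0 i3 = lswap (N i0 i2) := Ninv i0 i2.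
have N13 : N i1 i3 = lswap (N i1 i2) := Ninv i1 i2.
have N32 : N i3 i2 = lswap (N i2 i3) := Ninv i2 i3.
have N33 : N i3 i3 = lswap (N i2 i2) := Ninv i2 i2.
rewrite !mxE !sum_I4 N03 N13 N32 N33.
move: (M i2 i0) (M i2 i1) (M i2 i2) (M i2 i3) => m0 m1 m2 m3.
move: (N i0 i2) (N i1 i2) (N i2 i2) (N i2 i3) => a b c d.
apply/eqP; rewrite -subr_eq0 -rmorphB; apply/eqP/delta_dvd_ker.
move: (delta_dvd_swap a) (delta_dvd_swap b) (delta_dvd_swap c) (delta_dvd_swap d).
move: (lswap a) (lswap b) (lswap c) (lswap d) => a' b' c' d' [u au] [v bv] [w cw] [z dz].
exists (m0 * u + m1 * v + m3 * (w - z)).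
transitivity (m0 * (a - a') + m1 * (b - b') + m3 * ((c - c') - (d - d'))).
  by ring.
by rewrite au bv cw dz; ring.
Qed.

HB.instance Definition _ := GRing.isLinear.Build rat S22 L *:%R S22_pi
  S22_pi_is_linear.
HB.instance Definition _ := GRing.isMonoidMorphism.Build S22 L S22_pi
  S22_pi_is_monoid_morphism.

Lemma S22_pi_tr f : S22_pi (S22_tr f) = S22_pi f.
Proof.
have M32 : S22_mx f i3 i2 = lswap (S22_mx f i2 i3) := S22_mx_inv f i2 i3.
by rewrite /S22_pi S22_trE !mxE M32 !rmorphB /= ldiag_swap.
Qed.

(** For f in the kernel, the entries at [i2] and [i3] of each row of its matrix M agree modulo x1 -
    x2. This allows solving M = Y P^T, and Y, having fixed columns, factors as P X. *)
Lemma cell_beta_ker f : S22_pi f = 0 <-> range cell_beta f.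
Proof.
split=> [f0|[X _ <-]]; last first.
  rewrite /S22_pi cell_betaE; apply/delta_dvd_ker; move: (P *m _) => Y.
  by exists (Y i2 i3); rewrite !mxE !sum_I4 !mxE /=; ring.
have Minv := S22_mx_inv f.
have Mdvd i : delta_dvd (S22_mx f i i2 - S22_mx f i i3).
  elim/I4_ind: i.
  - by rewrite (Minv i0 i2 : _ = lswap _); exact: delta_dvd_swap.
  - by rewrite (Minv i1 i2 : _ = lswap _); exact: delta_dvd_swap.
  - exact/delta_dvd_ker.
  rewrite (Minv i2 i3 : S22_mx f i3 i2 = _) (Minv i2 i2 : S22_mx f i3 i3 = _).
  apply/delta_dvd_ker; move: f0; rewrite /S22_pi !rmorphB /= !ldiag_swap.
  by move=> f0; rewrite -opprB f0 oppr0.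
have [q qE] : exists q, forall i, S22_mx f i i2 - S22_mx f i i3 = (lx1 - lx2) * q i.
  by exists (fun i => sval (cid (Mdvd i))) => i; case: cid.
have [Y YE] : exists Y, S22_mx f = Y *m P^T.
  (* The solution of y_2 + x1 y_3 = M_i2 and y_2 + x2 y_3 = M_i3 is y_3 = q_i, y_2 = M_i2 - x1
     q_i. *)
  exists (\matrix_(i, j) if j == i3 then q i
    else if j == i2 then S22_mx f i i2 - lx1 * q i else S22_mx f i j).
  apply/matrixP => i j; rewrite mxE sum_I4 !mxE /=.
  elim/I4_ind: j => /=; rewrite ?mulr0 ?mulr1 ?addr0 ?add0r //.
    by rewrite mulrC subrK.
  by rewrite -[LHS](subKr (S22_mx f i i2)) qE; ring.
have Ycol : swap_col Y.
  (* The twisted swap of Y solves the same equation, as M and P are invariant; cancelling P^T gives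
     Y' = Y. *)
  pose Y' : 'M[R]_4 := \matrix_(i, j) lswap (Y (isw i) j).
  suff Y'E : Y' = Y by move=> i j; rewrite -[in RHS]Y'E [Y' _ _]mxE lswapK.
  apply: cell_basis_trinj; rewrite /= -YE; apply/matrixP => i j.
  rewrite -[in RHS](iswK i) -[in RHS](iswK j) Minv YE mxE [in RHS]mxE raddf_sum.
  apply: eq_bigr => l _; rewrite [Y' _ _]mxE ![P^T _ _]mxE /= rmorphM /=.
  by have := swap_col_basis (isw j) l; rewrite iswK => ->.
have [X YX] := cell_basis_solve Ycol.
by exists X => //; apply: S22_mx_inj; rewrite cell_betaE -YX.
Qed.

(** * The two cell ideals *)

Lemma symmxP m n c (X Y : kmx (symlaurent : comAlgType rat) m n) :
  symmx (c *: X + Y) = c *: (symmx X : kmx R m n) + (symmx Y : kmx R m n).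
Proof. by apply/matrixP => i j; rewrite kmxD kmxZ !mxE linearP. Qed.

Lemma S22_mx_linear c f g :
  S22_mx (c *: f + g) = c *: (S22_mx f : kmx R 4 4) + (S22_mx g : kmx R 4 4).
Proof. by apply/matrixP => i j; rewrite S22_mxP kmxD kmxZ. Qed.

Lemma cell_rho_linear : linear cell_rho.
Proof.
move=> c f g; apply: cell_rho_eq.
by rewrite symmxP kmxMPr -!cell_rhoE -kmxMPl S22_mx_linear.
Qed.

Lemma cell_rho1 : cell_rho 1 = 1%:M.
Proof. by apply: cell_rho_eq; rewrite S22_mx1 map_mx1 mul1mx mulmx1. Qed.

Lemma cell_rhoM f g : cell_rho (f * g) = cell_rho f *m cell_rho g.
Proof.
apply: cell_rho_eq.
by rewrite S22_mxM map_mxM mulmxA -cell_rhoE -!mulmxA cell_rhoE.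
Qed.

Lemma cell_beta_linear : linear cell_beta.
Proof.
move=> c X Y; apply: S22_mx_inj.
by rewrite S22_mx_linear !cell_betaE symmxP kmxMPr kmxMPl.
Qed.

Lemma cell_beta_inj : injective cell_beta.
Proof.
move=> X Y /(congr1 S22_mx); rewrite !cell_betaE.
by move=> /cell_basis_trinj/cell_basis_inj/symmx_inj.
Qed.

Lemma cell_beta_mull f X : f * cell_beta X = cell_beta (cell_rho f *m X).
Proof.
by apply: S22_mx_inj; rewrite S22_mxM !cell_betaE !mulmxA cell_rhoE map_mxM mulmxA.
Qed.

Lemma S22_tr_beta X : S22_tr (cell_beta X) = cell_beta X^T.
Proof.
by apply: S22_mx_inj; rewrite S22_trE !cell_betaE !trmx_mul trmxK map_trmx mulmxA.
Qed.

Lemma cell_beta_ideal : @affine_cell_ideal rat S22 S22_tr (range cell_beta).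
Proof.
exact: (affine_cell_ideal_mx symlaurent_affine S22_tr_kinvolution cell_rho_linear
  cell_rho1 cell_rhoM cell_beta_linear cell_beta_inj cell_beta_mull S22_tr_beta).
Qed.

(** The matrix criterion for n = 1, with B acting on itself by multiplication. *)
Lemma affine_cell_ideal_self (k : idomainType) (B : comAlgType k) :
  affine_algebra B -> affine_cell_ideal (id : B -> B) setT.
Proof.
move=> B_affine; pose beta (X : kmx B 1 1) : B := X 0 0.
have betaE b : beta b%:M = b by rewrite /beta mxE.
have -> : setT = range beta.
  by apply/esym/seteqP; split=> // b _; exists b%:M.
apply: (@affine_cell_ideal_mx _ _ _ _ _ (fun b => b%:M : kmx B 1 1)) => //.
- exact: id_kinvolution.
- by move=> c a b; rewrite scalar_mxP.
- by move=> a b; rewrite scalar_mxM.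
- by move=> c X Y; rewrite /beta kmxD kmxZ.
- by move=> X Y XY; apply/matrixP => i j; rewrite !ord1.
- by move=> a X; rewrite /beta mul_scalar_mx mxE.
- by move=> X; rewrite /beta mxE.
Qed.

(** * A complement of the kernel, made of diagonal matrices *)

Definition diag_entry (l : L) (i : 'I_4) : R :=
  if i == i2 then linc l else if i == i3 then lswap (linc l) else 0.

Definition diag_section_mx (l : L) : 'M[R]_4 := diag_mx (\row_j diag_entry l j).

HB.lock Definition diag_section (l : L) : S22 := S22_of (diag_section_mx l).

Lemma diag_section_mxE l i j :
  diag_section_mx l i j = if i == j then diag_entry l i else 0.
Proof. by rewrite !mxE; case: eqP => [->|]. Qed.

Lemma diag_sectionE l i j :
  S22_mx (diag_section l) i j = if i == j then diag_entry l i else 0.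
Proof.
rewrite diag_section.unlock -diag_section_mxE S22_ofK // => k m.
rewrite !diag_section_mxE (inj_eq (inv_inj iswK)).
by case: eqP => _; [elim/I4_ind: k => /=; rewrite ?raddf0 ?lswapK | rewrite raddf0].
Qed.

Lemma diag_section_linear : linear diag_section.
Proof.
move=> c l m; apply: S22_mx_inj; apply/matrixP => i j.
rewrite [RHS]S22_mxP [LHS]diag_sectionE (diag_sectionE l) (diag_sectionE m).
case: eqP => _; last by rewrite scaler0 addr0.
rewrite /diag_entry; case: eqP => _; first exact: gmap_is_linear.
case: eqP => _; last by rewrite scaler0 addr0.
by rewrite -gmap_is_linear; congr lswap; exact: gmap_is_linear.
Qed.

Lemma diag_sectionK : cancel diag_section S22_pi.
Proof. by move=> l; rewrite /S22_pi !diag_sectionE /= subr0 lincK. Qed.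

Lemma S22_tr_section l : S22_tr (diag_section l) = diag_section l.
Proof.
apply: S22_mx_inj; apply/matrixP => i j.
by rewrite S22_trE mxE !diag_sectionE eq_sym; case: eqP => [->|].
Qed.

(** * The decomposition and its layers *)

Definition S22_summand (j : 'I_2) : set S22 :=
  if j == ord0 then range cell_beta else range diag_section.

Lemma S22_summand_submodule j : submodule (S22_summand j).
Proof.
rewrite /S22_summand; case: eqP => _; apply: linear_range_submodule.
  exact: cell_beta_linear.
exact: diag_section_linear.
Qed.

Lemma sub_section_beta f : range cell_beta (f - diag_section (S22_pi f)).
Proof. by apply/cell_beta_ker; rewrite raddfB /= diag_sectionK subrr. Qed.

(** The section splits off [diag_section (S22_pi f)] from f; uniqueness follows by applying
    [S22_pi], which kills the first summand and is injective on the second. *)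
Lemma S22_decomposition : direct_decomposition S22_summand.
Proof.
split=> [|f]; first exact: S22_summand_submodule.
pose x : {ffun 'I_2 -> S22} := [ffun j =>
  if j == ord0 then f - diag_section (S22_pi f) else diag_section (S22_pi f)].
exists x; split.
  split; last by rewrite !big_ord_recl big_ord0 !ffunE /= addr0 subrK.
  move=> j; rewrite /S22_summand ffunE; case: eqP => _; last by exists (S22_pi f).
  exact: sub_section_beta.
move=> y [yJ fE]; have := yJ (lift ord0 ord0); have := yJ ord0.
rewrite /S22_summand /= => /cell_beta_ker y0 [l _ lE].
have piE : S22_pi f = l.
  by rewrite fE !big_ord_recl big_ord0 addr0 raddfD /= y0 add0r -lE diag_sectionK.
apply/ffunP => j; rewrite ffunE piE; case: eqP => [->|/eqP jn0].
  by rewrite fE !big_ord_recl big_ord0 addr0 lE addrK.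
rewrite lE; congr (y _); apply: val_inj.
by case: j jn0 => -[|[|//]] ? // /eqP[]; apply: val_inj.
Qed.

Lemma layer0 : layer S22_summand 0 = [set 0]%classic.
Proof.
apply/seteqP; split=> [a [x _ ->]|_ ->] /=; first by rewrite big_pred0.
by exists (fun _ => 0) => [l|]; [have [] := S22_summand_submodule l | rewrite big_pred0].
Qed.

Lemma layer1 : layer S22_summand 1 = range cell_beta.
Proof.
apply/seteqP; split=> [a [x xJ ->]|a aJ] /=.
  by rewrite big_mkcond !big_ord_recl big_ord0 /= !addr0; have := xJ ord0.
exists (fun l => if l == ord0 then a else 0) => [l|].
  have [Jl0 _] := S22_summand_submodule l; move: Jl0.
  by rewrite /S22_summand; case: eqP.
by rewrite big_mkcond !big_ord_recl big_ord0 /= !addr0.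
Qed.

Lemma layer2 : layer S22_summand 2 = setT.
Proof.
apply/seteqP; split=> // f _; have [_ /(_ f)[x [[xJ fE] _]]] := S22_decomposition.
by exists x => //; rewrite fE; apply: eq_bigl => l; rewrite ltn_ord.
Qed.

Lemma S22_tr_summand j : (S22_tr @` S22_summand j)%classic = S22_summand j.
Proof.
rewrite /S22_summand; case: eqP => _; first by have [] := cell_beta_ideal.
apply/seteqP; split=> f /=.
  by case=> g [l _ <-] <-; exists l; rewrite ?S22_tr_section.
by case=> l _ <-; exists (diag_section l); [exists l | rewrite S22_tr_section].
Qed.

Lemma trivial_ideals (k : idomainType) (A : algType k) :
  two_sided_ideal ([set 0]%classic : set A) /\ two_sided_ideal (setT : set A).
Proof.
by split; split=> //; [split=> // c x y -> ->; rewrite scaler0 addr0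
  | move=> a _ ->; rewrite mulr0 | move=> a _ ->; rewrite mul0r].
Qed.

Theorem theorem4p6 :
  exists tau : S22 -> S22,
    @kinvolution rat S22 tau /\ @affine_cellular rat S22 tau.
Proof.
exists S22_tr; split; first exact: S22_tr_kinvolution.
have [set0_ideal setT_ideal] := @trivial_ideals rat S22.
exists 2, S22_summand; split.
- exact: S22_decomposition.
- exact: S22_tr_summand.
- case=> [|[|[|//]]] _; rewrite ?layer0 ?layer1 ?layer2 //.
  by have [] := cell_beta_ideal.
case=> -[|[|//]] j_lt.
  (* The bottom layer is an ideal of S(2,2) modulo 0, presented by the identity. *)
  exists S22, (idfun : {lrmorphism S22 -> S22}), S22_tr; rewrite layer0 layer1 image_id.
  split=> //; [|exact: S22_tr_kinvolution | exact: cell_beta_ideal].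
  by split; [apply/seteqP; split=> // f _; exists f | exact: preimage_id].
(* The top quotient is Q[t, 1/t], on which the transpose induces the identity. *)
exists L, (S22_pi : {lrmorphism S22 -> L}), id; rewrite layer1 layer2.
have pi_surj : range S22_pi = setT.
  by apply/seteqP; split=> // l _; exists (diag_section l); rewrite ?diag_sectionK.
split; [split=> // | exact: id_kinvolution | by move=> f; exact/esym/S22_pi_tr |].
  by apply/seteqP; split=> f; rewrite /= cell_beta_ker.
by rewrite pi_surj; exact: affine_cell_ideal_self laurent_affine.
Qed.
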